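(* Let $\Gamma=\{x\in\mathbb{R}^3:F(x)=0\}$ be a smooth compact surface and let $T=\overline{o_0o_1o_2o_3}$ be a tetrahedron consistent with $\Gamma$. Case 1. If $\operatorname{sgn}F(o_0)=\operatorname{sgn}F(o_1)=\operatorname{sgn}F(o_2)=\operatorname{sgn}F(o_3)$, then $\Gamma\cap T=\emptyset$. Case 2. If $-\operatorname{sgn}F(o_0)=\operatorname{sgn}F(o_1)=\operatorname{sgn}F(o_2)=\operatorname{sgn}F(o_3)$, then the map $$\varphi:T\cap\Gamma\to\triangle o_1o_2o_3,$$ sending $p$ to the intersection of the ray from $o_0$ through $p$ with $\triangle o_1o_2o_3$, is bijective. Case 3. If $-\operatorname{sgn}F(o_0)=-\operatorname{sgn}F(o_1)=\operatorname{sgn}F(o_2)=\operatorname{sgn}F(o_3)$, let $p=\overline{o_1o_2}\cap\Gamma$ (a single point), $T_1=\overline{o_0o_1o_3p}$ and $T_2=\overline{o_0o_2o_3p}$. Then the maps $$\varphi_1:T_1\cap\Gamma\to\triangle o_0o_1p,\qquad \varphi_2:T_2\cap\Gamma\to\triangle o_2o_3p,$$ where $\varphi_1$ sends $q$ to the intersection of the ray from $o_3$ through $q$ with $\triangle o_0o_1p$, and $\varphi_2$ sends $q$ to the intersection of the ray from $o_0$ through $q$ with $\triangle o_2o_3p$, are both bijections, and $T\cap\Gamma=(T_1\cap\Gamma)\cup(T_2\cap\Gamma)$.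
   Context: $\Gamma$ is a compact regular level set of a smooth function $F$, i.e. $\nabla F\ne0$ on $\Gamma$. The reach $r_\Gamma$ is the supremum of all $r>0$ such that every $x$ with $\operatorname{dist}(x,\Gamma)<r$ has a unique closest point on $\Gamma$. $K_\Gamma=\max_{x\in\Gamma}\max\{|\kappa_1(x)|,|\kappa_2(x)|\}$, with $\kappa_1,\kappa_2$ the principal curvatures. $\overline{a_0\cdots a_k}$ denotes the closed simplex (convex hull) with the given vertices. With $h_T=\operatorname{diam}(T)$, $T=\overline{o_0o_1o_2o_3}$ is consistent with $\Gamma$ if $h_T<r_\Gamma$, $h_TK_\Gamma\le\frac14$, and, for a constant $c_0>0$ (independent of $h_T$), $\operatorname{dist}(o_i,\Gamma)>\max\{c_0h_T,K_\Gamma h_T^2\}$ for $i=0,1,2,3$. *)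

(* Defs.v *)
From HB Require Import structures.
From mathcomp Require Import all_boot all_order all_algebra.
From mathcomp Require Import all_classical all_reals all_analysis.

Set Implicit Arguments.
Unset Strict Implicit.
Unset Printing Implicit Defensive.

Import Order.TTheory GRing.Theory Num.Theory.
Import numFieldNormedType.Exports.

Local Open Scope classical_set_scope.
Local Open Scope ring_scope.

(* The library norm on 'rV[R]_3 is the sup norm; it is used only through the
   topology (compactness, continuity, derivatives).  All metric notions below
   are Euclidean. *)

Definition dot (R : realType) (u v : 'rV[R]_3) : R := \sum_i u 0 i * v 0 i.

Definition enorm (R : realType) (u : 'rV[R]_3) : R := Num.sqrt (dot u u).

Definition edistance (R : realType) (x y : 'rV[R]_3) : R := enorm (x - y).

(* As inf set0 = 0, the distance to the empty set is 0. *)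
Definition dist (R : realType) (x : 'rV[R]_3) (A : set 'rV[R]_3) : R :=
  inf [set edistance x y | y in A].

Definition diam (R : realType) (A : set 'rV[R]_3) : R :=
  sup [set d | exists x y, [/\ A x, A y & d = edistance x y]].

(* Closed simplex (convex hull) with vertices s; s`_i is the i-th vertex. *)
Definition simplex (R : realType) (s : seq 'rV[R]_3) : set 'rV[R]_3 :=
  [set x | exists l : 'I_(size s) -> R,
     [/\ forall i, 0 <= l i, \sum_i l i = 1 & x = \sum_i l i *: s`_i]].

Definition affinely_independent (R : realType) (o0 o1 o2 o3 : 'rV[R]_3) : bool :=
  free [:: o1 - o0; o2 - o0; o3 - o0].

Definition partial (R : realType) (i : 'I_3) (f : 'rV[R]_3 -> R) :
    'rV[R]_3 -> R :=
  fun x => 'D_(delta_mx 0 i) f x.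

Definition iter_partial (R : realType) (s : seq 'I_3) (f : 'rV[R]_3 -> R) :
    'rV[R]_3 -> R :=
  foldr (@partial R) f s.

(* C^oo: the partial derivatives of all orders exist and are continuous. *)
Definition smooth (R : realType) (f : 'rV[R]_3 -> R) : Prop :=
  forall s : seq 'I_3,
    continuous (iter_partial s f) /\
    forall (x : 'rV[R]_3) (i : 'I_3),
      derivable (iter_partial s f) x (delta_mx 0 i).

Definition grad (R : realType) (f : 'rV[R]_3 -> R) (x : 'rV[R]_3) : 'rV[R]_3 :=
  \row_i partial i f x.

Definition zero_set (R : realType) (F : 'rV[R]_3 -> R) : set 'rV[R]_3 :=
  [set x | F x = 0].

Definition regular_level_set (R : realType) (F : 'rV[R]_3 -> R) : Prop :=
  forall x, zero_set F x -> grad F x != 0.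

Definition unit_normal (R : realType) (F : 'rV[R]_3 -> R) (x : 'rV[R]_3) :
    'rV[R]_3 :=
  (enorm (grad F x))^-1 *: grad F x.

(* k is an eigenvalue of the shape operator v |-> - D_v n of the surface F = 0
   on the tangent plane at x, n being the unit normal. *)
Definition principal_curvature (R : realType) (F : 'rV[R]_3 -> R)
    (x : 'rV[R]_3) (k : R) : Prop :=
  exists v : 'rV[R]_3,
    [/\ v != 0, dot v (grad F x) = 0 & - 'D_v (unit_normal F) x = k *: v].

(* K_Gamma; for a nonempty compact regular level set of a smooth function this
   supremum is a maximum. *)
Definition max_curvature (R : realType) (F : 'rV[R]_3 -> R) : R :=
  sup [set c | exists x k,
         [/\ zero_set F x, principal_curvature F x k & c = `|k|]].

Definition closest_point (R : realType) (A : set 'rV[R]_3) (x y : 'rV[R]_3) :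
    Prop :=
  A y /\ forall z, A z -> edistance x y <= edistance x z.

Definition reach (R : realType) (A : set 'rV[R]_3) : \bar R :=
  ereal_sup [set r%:E | r in
    [set r : R | 0 < r /\
       forall x, dist x A < r -> exists! y, closest_point A x y]].

Definition consistent (R : realType) (F : 'rV[R]_3 -> R) (c0 : R)
    (o0 o1 o2 o3 : 'rV[R]_3) : Prop :=
  let Gamma := zero_set F in
  let h := diam (simplex [:: o0; o1; o2; o3]) in
  let K := max_curvature F in
  [/\ (h%:E < reach Gamma)%E,
      h * K <= 4^-1 &
      forall o, o \in [:: o0; o1; o2; o3] ->
        dist o Gamma > Num.max (c0 * h) (K * h ^+ 2)].

(* The ray from o through p, where p != o. *)
Definition ray (R : realType) (o p : 'rV[R]_3) : set 'rV[R]_3 :=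
  [set o + t *: (p - o) | t in [set t : R | 0 <= t]].

(* The intersection point of the ray from o through p with D; meaningful when
   that intersection is a singleton. *)
Definition ray_proj (R : realType) (o : 'rV[R]_3) (D : set 'rV[R]_3)
    (p : 'rV[R]_3) : 'rV[R]_3 :=
  get (ray o p `&` D).

(* Sending p in A to the intersection of the ray from o through p with D is a
   well-defined map A -> D, and it is bijective. *)
Definition ray_proj_bijective (R : realType) (o : 'rV[R]_3)
    (A D : set 'rV[R]_3) : Prop :=
  (forall p, A p -> p != o /\ ray o p `&` D = [set ray_proj o D p]) /\
  set_bij A D (ray_proj o D).

(* Main.v *)
Require Import Defs.
From HB Require Import structures.
From mathcomp Require Import all_boot all_order all_algebra.
From mathcomp Require Import all_classical all_reals all_analysis.
From mathcomp Require Import ring lra.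
Import Order.TTheory GRing.Theory Num.Theory.
Import numFieldNormedType.Exports.
Local Open Scope classical_set_scope.
Local Open Scope ring_scope.
Set Implicit Arguments.
Unset Strict Implicit.
Unset Printing Implicit Defensive.

(** Let h be the diameter of T, K the maximal curvature, and sdist the distance to
    the level set, signed by F.  Everything rests on one property, called visible
    below: if o is a vertex with F o < 0 and y is a point of T with F y <= 0, then
    F < 0 on the segment from o to y, y excluded; and likewise for - F.

    Visibility comes from an almost convexity of sdist.  If the level set meets
    the segment, all points of the segment are within h of it, hence within its
    reach.  There sdist is a distance function whose Hessian is at least
    - K / (1 - h K) >= - 4 K / 3.  With E = max (c0 h, K h ^ 2), the second derivative
    of sdist along a segment of length at most h, parametrized by t in [0, 1], is
    therefore larger than - 2 E, the second derivative of - (1 - t) ^ 2 E; the latter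
    function dominates sdist at both ends, because the vertex o has distance more
    than E from the level set, so it dominates sdist in between
    (segment_negative).

    The Hessian bound does not need the differentiability of sdist.  Let p be the
    nearest point of x, unique because of the reach.  A ball of radius rho tangent
    to the level set at p on the positive side is, for K rho < 1, locally contained
    in the positive side (tangent_ball_positive): the principal curvatures control
    the Hessian of F on tangent vectors, the minimum of that form being an
    eigenvalue of the shape operator (minimal_curvature_direction).  Since nearest
    points vary continuously at x, sdist is near x at least the signed distance to
    the boundary of this ball (sdist_ge_ball), an explicit function which equals
    sdist at x.  Touching functions of this kind suffice, since the comparison with
    - (1 - t) ^ 2 E only looks at a maximum point of a difference.

    The three cases follow from visibility and the intermediate value theorem.
    If all vertices are negative, F is negative on T, as T is an iterated cone over
    its vertices.  If only o0 is negative, F is positive on the opposite face, each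
    segment from o0 to this face contains a zero, and a second zero would make the
    nearer one negative.  If o0 and o1 are negative, the same argument on the edge
    from o1 to o2 gives p; visibility fixes the sign of F on the triangles o0 o1 p and
    o2 o3 p away from p, and the argument for one vertex applies to the two halves of
    T with apices o3 and o0. *)

(** * Euclidean geometry of R^3 *)

Section Euclid.
Variable R : realType.
Implicit Types (u v w x y z : 'rV[R]_3) (a : R).

Lemma dotE u v :
  dot u v = u 0 0 * v 0 0 + u 0 1 * v 0 1 + u 0 (1 + 1) * v 0 (1 + 1).
Proof.
rewrite /dot !big_ord_recl big_ord0 addr0 addrA.
by congr (_ + _ * _ + _ * _); congr (_ 0 _); apply: val_inj.
Qed.

Lemma dotC u v : dot u v = dot v u.
Proof. by rewrite !dotE; ring. Qed.

Lemma dotDl u v w : dot (u + v) w = dot u w + dot v w.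
Proof. by rewrite !dotE !mxE; ring. Qed.

Lemma dotZl a u v : dot (a *: u) v = a * dot u v.
Proof. by rewrite !dotE !mxE; ring. Qed.

Lemma dotDr u v w : dot u (v + w) = dot u v + dot u w.
Proof. by rewrite !dotE !mxE; ring. Qed.

Lemma dotZr a u v : dot u (a *: v) = a * dot u v.
Proof. by rewrite !dotE !mxE; ring. Qed.

Lemma dotNl u v : dot (- u) v = - dot u v.
Proof. by rewrite !dotE !mxE; ring. Qed.

Lemma dotNr u v : dot u (- v) = - dot u v.
Proof. by rewrite !dotE !mxE; ring. Qed.

Lemma dotBl u v w : dot (u - v) w = dot u w - dot v w.
Proof. by rewrite dotDl dotNl. Qed.

Lemma dotBr u v w : dot u (v - w) = dot u v - dot u w.
Proof. by rewrite dotDr dotNr. Qed.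

Lemma dot0l u : dot 0 u = 0.
Proof. by rewrite !dotE !mxE; ring. Qed.

Lemma dot_ge0 u : 0 <= dot u u.
Proof. by rewrite dotE -!expr2 !addr_ge0 ?sqr_ge0. Qed.

Lemma row3P u v : u 0 0 = v 0 0 -> u 0 1 = v 0 1 -> u 0 (1 + 1) = v 0 (1 + 1) ->
  u = v.
Proof.
move=> h0 h1 h2; apply/rowP => -[[|[|[|//]]] hi].
- by rewrite (_ : Ordinal hi = 0)//; apply: val_inj.
- by rewrite (_ : Ordinal hi = 1)//; apply: val_inj.
- by rewrite (_ : Ordinal hi = 1 + 1)//; apply: val_inj.
Qed.

Lemma dot_eq0 u : (dot u u == 0) = (u == 0).
Proof.
apply/idP/eqP => [|->]; last by rewrite dot0l.
rewrite dotE -!expr2 !paddr_eq0 ?addr_ge0 ?sqr_ge0// !sqrf_eq0.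
move=> /andP[/andP[/eqP h0 /eqP h1] /eqP h2].
by apply: row3P; rewrite ?h0 ?h1 ?h2 mxE.
Qed.

Lemma enorm_ge0 u : 0 <= enorm u.
Proof. exact: sqrtr_ge0. Qed.

Lemma enorm_sq u : enorm u ^+ 2 = dot u u.
Proof. by rewrite /enorm sqr_sqrtr ?dot_ge0. Qed.

Lemma enorm_eq0 u : (enorm u == 0) = (u == 0).
Proof. by rewrite -sqrf_eq0 enorm_sq dot_eq0. Qed.

Lemma enorm0 : enorm (0 : 'rV[R]_3) = 0.
Proof. by apply/eqP; rewrite enorm_eq0. Qed.

Lemma enorm_gt0 u : (0 < enorm u) = (u != 0).
Proof. by rewrite lt0r enorm_ge0 andbT enorm_eq0. Qed.

Lemma enormZ a u : enorm (a *: u) = `|a| * enorm u.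
Proof.
by rewrite /enorm dotZl dotZr mulrA -expr2 sqrtrM ?sqr_ge0// sqrtr_sqr.
Qed.

Lemma enormN u : enorm (- u) = enorm u.
Proof. by rewrite /enorm dotNl dotNr opprK. Qed.

Lemma cauchy_schwarz u v : `|dot u v| <= enorm u * enorm v.
Proof.
rewrite -(@ler_pXn2r _ 2)// ?nnegrE ?mulr_ge0 ?enorm_ge0// exprMn !enorm_sq.
rewrite real_normK ?num_real// -subr_ge0 !dotE.
set a := u 0 0; set b := u 0 1; set c := u 0 _.
set d := v 0 0; set e := v 0 1; set f := v 0 _.
rewrite (_ : _ - _ =
  (a * e - b * d) ^+ 2 + (a * f - c * d) ^+ 2 + (b * f - c * e) ^+ 2); last ring.
by rewrite !addr_ge0 ?sqr_ge0.
Qed.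

Lemma dot_le u v : dot u v <= enorm u * enorm v.
Proof. exact: le_trans (ler_norm _) (cauchy_schwarz _ _). Qed.

Lemma dot_ge u v : - (enorm u * enorm v) <= dot u v.
Proof. by have := cauchy_schwarz u v; rewrite ler_norml => /andP[]. Qed.

Lemma enormD u v : enorm (u + v) <= enorm u + enorm v.
Proof.
rewrite -(@ler_pXn2r _ 2)// ?nnegrE ?addr_ge0 ?enorm_ge0// enorm_sq sqrrD.
rewrite !enorm_sq dotDl !dotDr (dotC v u).
by have := dot_le u v; lra.
Qed.

Lemma enormB u v : enorm (u - v) <= enorm u + enorm v.
Proof. by rewrite (le_trans (enormD _ _))// enormN. Qed.

Lemma enormBC u v : enorm (u - v) = enorm (v - u).
Proof. by rewrite -enormN opprB. Qed.

Lemma enorm_tri u v w : enorm (u - w) <= enorm (u - v) + enorm (v - w).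
Proof. by rewrite -[u - w](subrKA v); exact: enormD. Qed.

(** This is 2 a b <= a ^ 2 + b ^ 2 with a = |u + v| and b = |u|; it does the work
    of a second-order expansion of the norm, without any derivative. *)
Lemma enormD_le_quad u v : u != 0 ->
  enorm (u + v) <= enorm u + dot u v / enorm u + dot v v / (2 * enorm u).
Proof.
rewrite -enorm_gt0 => u0.
have h : enorm (u + v) ^+ 2 = enorm u ^+ 2 + 2 * dot u v + dot v v.
  by rewrite !enorm_sq dotDl !dotDr (dotC v u); ring.
have u2 : 2 * enorm u != 0 by rewrite mulf_neq0// gt_eqF.
rewrite -(@ler_pM2r _ (2 * enorm u)) ?mulr_gt0//.
rewrite [leRHS](_ : _ =
  2 * enorm u ^+ 2 + 2 * dot u v + dot v v); last by field; rewrite gt_eqF.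
by have := sqr_ge0 (enorm (u + v) - enorm u); rewrite sqrrB h; lra.
Qed.

Lemma dot_delta i u : dot (delta_mx 0 i) u = u 0 i.
Proof.
rewrite /dot (bigD1 i)//= big1 => [|k ki]; first by rewrite !mxE !eqxx mul1r addr0.
by rewrite !mxE (negbTE ki) andbF mul0r.
Qed.

Lemma enorm_delta i : enorm (delta_mx 0 i : 'rV[R]_3) = 1.
Proof. by rewrite /enorm dot_delta mxE !eqxx sqrtr1. Qed.

Lemma coord_le_enorm u i : `|u 0 i| <= enorm u.
Proof.
rewrite -(@ler_pXn2r _ 2)// ?nnegrE ?enorm_ge0// enorm_sq real_normK ?num_real//.
rewrite /dot (bigD1 i)//= -expr2 lerDl; apply: sumr_ge0 => j _.
by rewrite -expr2 sqr_ge0.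
Qed.

Lemma norm_le_enorm u : `|u| <= enorm u.
Proof.
rewrite /Num.norm/= mx_normrE; apply: bigmax_le; first exact: enorm_ge0.
by move=> [i j] _ /=; rewrite (ord1 i) coord_le_enorm.
Qed.

Lemma coord_le_norm u i : `|u 0 i| <= `|u|.
Proof.
rewrite [leRHS]/Num.norm/= mx_normrE.
by apply: (@le_bigmax _ _ _ 0 (fun i : 'I_1 * 'I_3 => `|u i.1 i.2|) (0, i)).
Qed.

Lemma enorm_le_norm u : enorm u <= 2 * `|u|.
Proof.
rewrite -(@ler_pXn2r _ 2)// ?nnegrE ?enorm_ge0 ?mulr_ge0// enorm_sq.
have sq i : u 0 i * u 0 i <= `|u| ^+ 2.
  rewrite -expr2 -[leLHS]real_normK ?num_real// ler_pXn2r ?nnegrE//.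
  exact: coord_le_norm.
rewrite dotE exprMn.
by have := sq 0; have := sq 1; have := sq (1 + 1); have := sqr_ge0 `|u|; lra.
Qed.

Lemma near_enormP (x : 'rV[R]_3) (P : set 'rV[R]_3) :
  (exists2 d, 0 < d & forall y, enorm (y - x) < d -> P y) <-> nbhs x P.
Proof.
split=> [[d d0 dP]|/nbhs_ballP[d /= d0 dP]].
  apply/nbhs_ballP; exists (d / 2) => /=; first by rewrite divr_gt0.
  move=> y; rewrite -ball_normE/= distrC => xy; apply: dP.
  by apply: le_lt_trans (enorm_le_norm _) _; rewrite mulrC -ltr_pdivlMr.
exists d => // y xy; apply: dP; rewrite -ball_normE/= distrC.
exact: le_lt_trans (norm_le_enorm _) xy.
Qed.

Lemma continuous_enormP (f : 'rV[R]_3 -> R) :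
  continuous f <-> forall x e, 0 < e ->
    exists2 d, 0 < d & forall y, enorm (y - x) < d -> `|f y - f x| < e.
Proof.
split=> [cf x e e0|h x]; last first.
  apply/(@cvgrPdist_lt _ _ _ (nbhs x)) => e /(h x) H; apply/near_enormP.
  by case: H => d d0 H; exists d => // y /H; rewrite distrC.
have /cvgrPdist_lt/(_ e e0)/near_enormP[d d0 H] := cf x.
by exists d => // y /H; rewrite distrC.
Qed.

Lemma lipschitz_continuous (f : 'rV[R]_3 -> R) :
  (forall x y, f x - f y <= enorm (x - y)) -> continuous f.
Proof.
move=> fl; apply/continuous_enormP => x e e0; exists e => // y.
by apply: le_lt_trans; rewrite ler_norml -lerN2 opprK opprB fl enormBC fl.
Qed.

Lemma enorm_dist_continuous x : continuous (fun y => enorm (y - x)).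
Proof.
apply: lipschitz_continuous => y z.
by rewrite lerBlDr enorm_tri.
Qed.

Lemma dot_continuous v : continuous (fun y => dot v y).
Proof.
apply/continuous_enormP => x e e0.
have v1 : 0 < enorm v + 1 by rewrite ltr_wpDl ?enorm_ge0.
exists (e / (enorm v + 1)) => [|y xy]; first by rewrite divr_gt0.
rewrite -dotBr; apply: le_lt_trans (cauchy_schwarz _ _) _.
move: xy; rewrite ltr_pdivlMr// mulrC; apply: le_lt_trans.
by rewrite ler_wpM2r ?enorm_ge0// lerDl.
Qed.

Lemma dotr_continuous v : continuous (fun y => dot y v).
Proof.
by rewrite (_ : (fun y => _) = dot v); [exact: dot_continuous|apply/funext => y; exact: dotC].
Qed.

Lemma line_continuous x v : continuous (fun t : R => x + t *: v).
Proof.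
by move=> t; apply: cvgD; [exact: cvg_cst | exact: scalel_continuous].
Qed.

End Euclid.

(** * First and second order expansions from continuous partial derivatives *)

Section Calculus.
Variable R : realType.
Implicit Types (f F : 'rV[R]_3 -> R) (u v w x y : 'rV[R]_3).

Lemma ler_norm3 (a b c s t u : R) :
  `|a| <= s -> `|b| <= t -> `|c| <= u -> `|a + b + c| <= s + t + u.
Proof.
by move=> *; do 2 (apply: le_trans (ler_normD _ _) _; apply: lerD => //).
Qed.

Lemma thirdsM (e a : R) : e / 3 * a + e / 3 * a + e / 3 * a = e * a.
Proof. by field. Qed.

Definition C1 f :=
  (forall x i, derivable f x (delta_mx 0 i)) /\ forall i, continuous (partial i f).

Definition C2 F := C1 F /\ forall i, C1 (partial i F).

Lemma smooth_C2 F : smooth F -> C2 F.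
Proof.
move=> sF; split; [split=> [x i|i]|move=> i; split=> [x j|j]].
- exact: (sF [::]).2.
- exact: (sF [:: i]).1.
- exact: (sF [:: i]).2.
- exact: (sF [:: j; i]).1.
Qed.

Lemma row3_sum_delta v :
  v = v 0 0 *: delta_mx 0 0 + v 0 1 *: delta_mx 0 1 +
      v 0 (1 + 1) *: delta_mx 0 (1 + 1).
Proof. by apply: row3P; rewrite !mxE /=; ring. Qed.

Lemma is_derive_line f x v t df :
  is_derive (x + t *: v) v f df -> is_derive t 1 (fun s : R => f (x + s *: v)) df.
Proof.
set g := fun s : R => f (x + s *: v).
have E : (fun h : R => h^-1 *: ((f \o shift (x + t *: v)) (h *: v) - f (x + t *: v)))
       = (fun h : R => h^-1 *: ((g \o shift t) (h *: (1 : R)) - g t)).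
  apply/funext => h /=; rewrite /g /shift/= [h *: 1]mulr1 scalerDl.
  by rewrite addrCA.
by case=> H1 H2; split; rewrite /derivable /derive -E.
Qed.

Lemma is_derive_translate f x y v df :
  is_derive (x + y) v f df -> is_derive x v (fun z => f (z + y)) df.
Proof.
set g := fun z => f (z + y).
have E : (fun h : R => h^-1 *: ((f \o shift (x + y)) (h *: v) - f (x + y)))
       = (fun h : R => h^-1 *: ((g \o shift x) (h *: v) - g x)).
  by apply/funext => h /=; rewrite /g /shift/= addrA.
by case=> H1 H2; split; rewrite /derivable /derive -E.
Qed.

Lemma mvt_line f v : (forall y, derivable f y v) -> forall y s,
  exists2 th : R, 0 <= th <= 1 &
    f (y + s *: v) - f y = s * 'D_v f (y + (th * s) *: v).
Proof.
move=> df y s; pose g t := f (y + t *: v).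
have dg (t : R) : is_derive t (1 : R) g ('D_v f (y + t *: v)).
  by apply: is_derive_line; exact: derivableP.
have cg : continuous g.
  move=> t; have [dgt _] := dg t.
  by apply: differentiable_continuous; apply/derivable1_diffP.
have gs : f (y + s *: v) - f y = g s - g 0 by rewrite /g scale0r addr0.
case: (ltgtP s 0) => [s0|s0|->]; last 1 first.
- by exists 0; rewrite ?lexx ?ler01// scale0r addr0 subrr mul0r.
- have [c cs E] := MVT s0 (fun t _ => dg t) (continuous_subspaceT cg).
  exists (c / s); last first.
    by rewrite divfK ?lt_eqF// gs -(opprB (g 0)) E; ring.
  rewrite in_itv/= in cs; case/andP: cs => /ltW cs /ltW c0.
  by rewrite ler_ndivlMr// mul0r c0/= ler_ndivrMr// mul1r.
- have [c cs E] := MVT s0 (fun t _ => dg t) (continuous_subspaceT cg).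
  exists (c / s); last by rewrite divfK ?gt_eqF// gs E; ring.
  rewrite in_itv/= in cs; case/andP: cs => /ltW c0 /ltW cs.
  by rewrite (divr_ge0 c0 (ltW s0))/= ler_pdivrMr// mul1r.
Qed.

(** Moving from x to x + w one coordinate at a time turns the increment into
    three values of partial derivatives taken near x. *)
Lemma C1_expansion f x e : C1 f -> 0 < e ->
  exists2 d, 0 < d & forall w, enorm w < d ->
    `|f (x + w) - f x - dot w (grad f x)| <= e * enorm w.
Proof.
move=> [df cf] e0.
have e3 : 0 < e / 3 by rewrite divr_gt0.
have step i : exists2 d, 0 < d & forall y s, enorm (y - x) + `|s| < d ->
    `|f (y + s *: delta_mx 0 i) - f y - s * partial i f x| <= e / 3 * `|s|.
  have [d d0 H] := (continuous_enormP (partial i f)).1 (cf i) x _ e3.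
  exists d => // y s ysd.
  have [th /andP[th0 th1] ->] := mvt_line (fun y => df y i) y s.
  rewrite -mulrBr normrM mulrC ler_wpM2r//; apply/ltW/H.
  apply: le_lt_trans ysd; rewrite addrAC; apply: le_trans (enormD _ _) _.
  by rewrite lerD2l enormZ enorm_delta mulr1 normrM (ger0_norm th0) ler_piMl.
have [d0 d00 H0] := step 0; have [d1 d10 H1] := step 1.
have [d2 d20 H2] := step (1 + 1).
set m := Num.min d0 (Num.min d1 d2).
have m0 : 0 < m by rewrite !lt_min d00 d10.
exists (m / 3) => [|w wm]; first by rewrite divr_gt0.
have {}wm : 3 * enorm w < m by rewrite mulrC -ltr_pdivlMr.
have c0 := coord_le_enorm w 0; have c1 := coord_le_enorm w 1.
have c2 := coord_le_enorm w (1 + 1).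
pose y1 := x + w 0 0 *: delta_mx 0 0; pose y2 := y1 + w 0 1 *: delta_mx 0 1.
have nd (a : R) i : enorm (a *: delta_mx 0 i) = `|a|.
  by rewrite enormZ enorm_delta mulr1.
have n1 : enorm (y1 - x) <= enorm w by rewrite /y1 addrC addKr nd.
have n2 : enorm (y2 - x) <= enorm w + enorm w.
  rewrite (_ : y2 - x = (y1 - x) + w 0 1 *: delta_mx 0 1); last first.
    by rewrite /y2 addrAC.
  by apply: le_trans (enormD _ _) _; rewrite nd lerD.
have n3 : enorm w + enorm w + enorm w = 3 * enorm w by ring.
have n0 : enorm (x - x) = 0 by rewrite subrr enorm0.
move: wm; rewrite !lt_min -n3 => /and3P[wm0 wm1 wm2].
have {}wm0 : enorm (x - x) + `|w 0 0| < d0.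
  apply: le_lt_trans wm0; rewrite n0 add0r; apply: le_trans c0 _.
  by rewrite lerDr addr_ge0 ?enorm_ge0.
have {}wm1 : enorm (y1 - x) + `|w 0 1| < d1.
  apply: le_lt_trans wm1; apply: lerD c1; apply: le_trans n1 _.
  by rewrite lerDr enorm_ge0.
have {}wm2 : enorm (y2 - x) + `|w 0 (1 + 1)| < d2.
  by apply: le_lt_trans wm2; exact: lerD.
have M (a b : R) : a <= e / 3 * `|b| -> `|b| <= enorm w -> a <= e / 3 * enorm w.
  by move=> + ab; move/le_trans; apply; rewrite ler_wpM2l// ltW.
have := M _ _ (H0 _ _ wm0) c0; have := M _ _ (H1 _ _ wm1) c1.
have := M _ _ (H2 _ _ wm2) c2.
rewrite -/y1 -/y2 (_ : y2 + w 0 (1 + 1) *: delta_mx 0 (1 + 1) = x + w); last first.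
  by rewrite [in RHS](row3_sum_delta w) /y2 /y1 !addrA.
rewrite dotE !mxE; move: (f (x + w)) (f y2) (f y1) => A B C.
move: (partial 0 f x) (partial 1 f x) (partial (1 + 1) f x) => p q r K2 K1 K0.
rewrite (_ : A - _ - _ = (A - B - w 0 (1 + 1) * r)
  + (B - C - w 0 1 * q) + (C - f x - w 0 0 * p)); last ring.
apply: le_trans (ler_norm3 K2 K1 K0) _.
by rewrite thirdsM.
Qed.

Lemma C1_is_derive f x v : C1 f -> is_derive x v f (dot v (grad f x)).
Proof.
move=> Cf.
suff H : (fun h : R => h^-1 *: ((f \o shift x) (h *: v) - f x)) @ 0^' -->
    dot v (grad f x).
  by split; [apply/cvg_ex; exists (dot v (grad f x))|exact: cvg_lim].
apply/cvgrPdist_le => e e0.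
have v1 : 0 < enorm v + 1 by rewrite ltr_wpDl ?enorm_ge0.
have [d d0 H] := C1_expansion x Cf (divr_gt0 e0 v1).
near=> h.
have hn0 : h != 0 by near: h; exact: nbhs_dnbhs_neq.
have hd : `|h| < d / (enorm v + 1).
  by near: h; apply: dnbhs0_lt; rewrite divr_gt0.
rewrite /= [h *: v + x]addrC distrC -(@ler_pM2l _ `|h|) ?normr_gt0// -normrM.
rewrite mulrBr /GRing.scale/= mulVKf// -dotZl.
have hv : enorm (h *: v) <= `|h| * (enorm v + 1).
  by rewrite enormZ ler_wpM2l// lerDl.
apply: le_trans (H _ _) _; first by apply: le_lt_trans hv _; rewrite -ltr_pdivlMr.
apply: le_trans (ler_wpM2l _ hv) _; first by rewrite divr_ge0// ltW.
by rewrite mulrCA divfK ?gt_eqF// mulrC.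
Unshelve. all: by end_near. Qed.

Lemma C1_continuous f : C1 f -> continuous f.
Proof.
move=> Cf; apply/continuous_enormP => x e e0.
have [d d0 H] := C1_expansion x Cf ltr01.
set g := enorm (grad f x); have g2 : 0 < g + 2 by rewrite ltr_wpDl ?enorm_ge0.
exists (Num.min d (e / (g + 2))) => [|y]; first by rewrite lt_min d0 divr_gt0.
rewrite lt_min => /andP[yd]; rewrite ltr_pdivlMr// => ye.
have := H _ yd; rewrite subrKC mul1r => K.
have D := cauchy_schwarz (y - x) (grad f x).
have n0 := enorm_ge0 (y - x).
rewrite -[f y - f x](subrK (dot (y - x) (grad f x))).
apply: le_lt_trans (ler_normD _ _) _.
rewrite -/g in D; nra.
Qed.

(** The Hessian of F at x applied to v, that is, the derivative of the gradient
    in the direction v. *)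
Definition hess F x v : 'rV[R]_3 := \row_i dot v (grad (partial i F) x).

Lemma hessD F x v w : hess F x (v + w) = hess F x v + hess F x w.
Proof. by apply/rowP => i; rewrite !mxE dotDl. Qed.

Lemma hessZ F x a v : hess F x (a *: v) = a *: hess F x v.
Proof. by apply/rowP => i; rewrite !mxE dotZl. Qed.

(** One mean value step in the direction i turns the second difference into an
    increment of a first partial derivative, which has a first-order expansion. *)
Lemma second_difference F x i j e : C2 F -> 0 < e ->
  exists2 d, 0 < d & forall s : R, 0 < s -> s < d ->
    `|F (x + s *: delta_mx 0 i + s *: delta_mx 0 j) - F (x + s *: delta_mx 0 i)
      - (F (x + s *: delta_mx 0 j) - F x)
      - s ^+ 2 * partial j (partial i F) x| <= e * s ^+ 2.
Proof.
move=> [[dF _] CiF] e0.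
have e3 : 0 < e / 3 by rewrite divr_gt0.
have [d d0 H] := C1_expansion x (CiF i) e3.
exists (d / 2) => [|s s0 sd]; first by rewrite divr_gt0.
set a := delta_mx 0 i; set b := delta_mx 0 j.
have nd k := enorm_delta R k.
have db g : dot b (grad g x) = partial j g x by rewrite dot_delta mxE.
pose G y := F (y + s *: b) - F y.
have sh y : is_derive y a (fun z => F (z + s *: b)) (partial i F (y + s *: b)).
  exact: (is_derive_translate (derivableP (dF (y + s *: b) i))).
have DG y : is_derive y a G (partial i F (y + s *: b) - partial i F y).
  exact: (is_deriveB (sh y) (derivableP (dF y i))).
have [th /andP[th0 th1]] := mvt_line (fun y => @ex_derive _ _ _ _ _ _ _ (DG y)) x s.
rewrite (@derive_val _ _ _ _ _ _ _ (DG _)) /G => ->.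
set c := th * s; have c0 : 0 <= c by rewrite mulr_ge0// ltW.
have cs : c <= s by rewrite /c ger_pMl.
have n2 : enorm (c *: a) = c by rewrite enormZ nd mulr1 ger0_norm.
have n1 : enorm (c *: a + s *: b) <= 2 * s.
  apply: le_trans (enormD _ _) _.
  by rewrite !enormZ !nd !mulr1 (ger0_norm c0) (ger0_norm (ltW s0)); lra.
have s2d : 2 * s < d by rewrite mulrC -ltr_pdivlMr.
have K1 := H _ (le_lt_trans n1 s2d).
have K2 : `|partial i F (x + c *: a) - partial i F x
    - dot (c *: a) (grad (partial i F) x)| <= e / 3 * c.
  by rewrite -[in leRHS]n2; apply: H; rewrite n2; lra.
rewrite dotDl !addrA !dotZl db in K1; rewrite dotZl in K2.
move: K1 K2 n1; move: (partial i F (x + c *: a + s *: b)) (partial i F (x + c *: a)).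
move: (dot a _) (partial j _ x) (partial i F x) (enorm _) => A B p n P Q K1 K2 n1.
rewrite (_ : _ - _ = s * ((P - p - (c * A + s * B)) - (Q - p - c * A))); last ring.
rewrite normrM (ger0_norm (ltW s0)) expr2 mulrCA ler_pM2l//.
apply: le_trans (ler_normB _ _) _.
have n3 : e / 3 * n <= e / 3 * (2 * s) by rewrite ler_wpM2l// ltW.
have c3 : e / 3 * c <= e / 3 * s by rewrite ler_wpM2l// ltW.
rewrite (_ : e * s = e / 3 * (2 * s) + e / 3 * s); last by field.
exact: lerD (le_trans K1 n3) (le_trans K2 c3).
Qed.

(** Symmetry of second derivatives: the mixed second difference does not change
    when the two directions are exchanged, and it approximates both mixed
    partial derivatives. *)
Lemma partial_comm F x i j : C2 F ->
  partial j (partial i F) x = partial i (partial j F) x.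
Proof.
move=> CF; apply/eqP; rewrite -subr_eq0 -normr_le0; apply/ler_addgt0Pl => e e0.
rewrite addr0; have e2 : 0 < e / 2 by rewrite divr_gt0.
have [d1 d10 H1] := second_difference x i j CF e2.
have [d2 d20 H2] := second_difference x j i CF e2.
set s := Num.min d1 d2 / 2.
have m0 : 0 < Num.min d1 d2 by rewrite lt_min d10.
have s0 : 0 < s by rewrite divr_gt0.
have sm : s < Num.min d1 d2 by rewrite /s; lra.
move: sm; rewrite lt_min => /andP[s1 s2].
have := H1 s s0 s1; have := H2 s s0 s2.
rewrite (addrAC x (s *: delta_mx 0 j)).
move: (F (x + s *: delta_mx 0 i + s *: delta_mx 0 j)).
move: (F (x + s *: delta_mx 0 i)) (F (x + s *: delta_mx 0 j)).
move: (partial i (partial j F) x) (partial j (partial i F) x) (F x) => p q D B C A K2 K1.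
have s20 : 0 < s ^+ 2 by rewrite exprn_gt0.
rewrite -(ler_pM2l s20) -[X in X * _](ger0_norm (ltW s20)) -normrM mulrBr.
rewrite (_ : _ - _ = (A - C - (B - D) - s ^+ 2 * p) - (A - B - (C - D) - s ^+ 2 * q));
  last ring.
apply: le_trans (ler_normB _ _) _.
by rewrite (splitr e) mulrDr; apply: lerD; rewrite [leRHS]mulrC.
Qed.

Lemma symmetric_form (H : 'I_3 -> 'I_3 -> R) v w : (forall i j, H i j = H j i) ->
  dot (\row_i dot v (\row_j H i j)) w = dot v (\row_i dot w (\row_j H i j)).
Proof.
move=> sH; rewrite !dotE !mxE !dotE !mxE (sH 1 0) (sH (1 + 1) 0) (sH (1 + 1) 1).
ring.
Qed.

Lemma hess_sym F x v w : C2 F -> dot (hess F x v) w = dot v (hess F x w).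
Proof. by move=> CF; apply: symmetric_form => i j; exact: partial_comm. Qed.

(** The first-order expansions of the partial derivatives bound by e |w| ^ 2 the
    derivative in t of the remainder at x + t w, and the mean value theorem on
    [0, 1] passes the bound on to the remainder. *)
Lemma taylor2 F x e : C2 F -> 0 < e ->
  exists2 d, 0 < d & forall w, enorm w < d ->
    `|F (x + w) - F x - dot w (grad F x) - dot w (hess F x w) / 2|
      <= e * dot w w.
Proof.
move=> [CF CiF] e0.
have e3 : 0 < e / 3 by rewrite divr_gt0.
have [d0 d00 H0] := C1_expansion x (CiF 0) e3.
have [d1 d10 H1] := C1_expansion x (CiF 1) e3.
have [d2 d20 H2] := C1_expansion x (CiF (1 + 1)) e3.
exists (Num.min d0 (Num.min d1 d2)) => [|w]; first by rewrite !lt_min d00 d10.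
rewrite !lt_min => /and3P[w0 w1 w2].
pose g t := F (x + t *: w) - t * dot w (grad F x) - t ^+ 2 * (dot w (hess F x w) / 2).
pose dg t := dot w (grad F (x + t *: w)) - dot w (grad F x) - t * dot w (hess F x w).
have Dg (t : R) : is_derive t (1 : R) g (dg t).
  have h1 : is_derive t 1 (fun s : R => F (x + s *: w)) (dot w (grad F (x + t *: w))).
    exact/is_derive_line/C1_is_derive.
  apply: is_derive_eq.
  rewrite /dg [in LHS]/GRing.scale/=; move: (dot w _) (dot w _) (dot w _) => p q r.
  by field.
have cg : continuous g.
  move=> t; have [dgt _] := Dg t.
  by apply: differentiable_continuous; apply/derivable1_diffP.
have [c] := MVT ltr01 (fun t _ => Dg t) (continuous_subspaceT cg).
rewrite in_itv/= => /andP[c0 c1]; rewrite subr0 mulr1 {1}/g scale1r expr1n !mul1r.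
rewrite /g scale0r addr0 !mul0r expr0n /= mul0r !subr0 => E.
rewrite (_ : _ - _ - _ = dg c); last by rewrite -E; ring.
rewrite /dg.
have nc : enorm (c *: w) <= enorm w.
  by rewrite enormZ gtr0_norm// ler_piMl ?enorm_ge0// ltW.
rewrite -dotZr -!dotBr; set G := (X in dot w X).
have K i d : (forall w, enorm w < d -> `|partial i F (x + w) - partial i F x
    - dot w (grad (partial i F) x)| <= e / 3 * enorm w) -> enorm w < d ->
  `|w 0 i * G 0 i| <= e / 3 * dot w w.
  move=> H wd; rewrite normrM -enorm_sq expr2 mulrCA.
  apply: ler_pM => //; first exact: coord_le_enorm.
  rewrite !mxE -dotZl; apply: le_trans (H _ (le_lt_trans nc wd)) _.
  by rewrite ler_wpM2l// ltW.
apply: le_trans (_ : _ <= e / 3 * dot w w + e / 3 * dot w w + e / 3 * dot w w) _.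
  by rewrite [dot w G]dotE; apply: ler_norm3; [exact: K H0 w0|exact: K H1 w1|exact: K H2 w2].
by rewrite thirdsM.
Qed.

End Calculus.

(** * Curvature and tangent balls of a level set *)

Section Curvature.
Variable R : realType.
Implicit Types (f F : 'rV[R]_3 -> R) (n u v w x y p : 'rV[R]_3).

Lemma is_derive_of_line f x v df :
  is_derive 0 (1 : R) (fun s : R => f (x + s *: v)) df -> is_derive x v f df.
Proof.
set g := fun s : R => f (x + s *: v).
have E : (fun h : R => h^-1 *: ((f \o shift x) (h *: v) - f x))
       = (fun h : R => h^-1 *: ((g \o shift 0) (h *: (1 : R)) - g 0)).
  apply/funext => h /=; rewrite /g /shift/= [h *: 1]mulr1 scale0r !addr0.
  by rewrite [x + _]addrC.
by case=> H1 H2; split; rewrite /derivable /derive E.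
Qed.

Lemma derive_unit_normal F x v : C2 F -> grad F x != 0 ->
  'D_v (unit_normal F) x = (enorm (grad F x))^-1 *:
    (hess F x v - dot (unit_normal F x) (hess F x v) *: unit_normal F x).
Proof.
move=> [CF CiF] G0.
pose p i (t : R) := partial i F (x + t *: v).
have x0 : x + 0 *: v = x by rewrite scale0r addr0.
have dp i : is_derive 0 (1 : R) (p i) (hess F x v 0 i).
  by rewrite mxE; apply: is_derive_line; rewrite x0; exact: C1_is_derive.
pose q t : R := p 0 t * p 0 t + p 1 t * p 1 t + p (1 + 1) t * p (1 + 1) t.
have qE t : q t = dot (grad F (x + t *: v)) (grad F (x + t *: v)).
  by rewrite dotE !mxE.
have sq0 : Num.sqrt (q 0) = enorm (grad F x) by rewrite qE x0.
have q0 : 0 < q 0 by rewrite qE x0 lt0r dot_eq0 G0 dot_ge0.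
set G := grad F x in G0 sq0 *; set H := hess F x v in dp *.
have p0 i : p i 0 = G 0 i by rewrite mxE /p x0.
have dq : is_derive 0 (1 : R) q (2 * dot G H).
  apply: is_derive_eq.
  rewrite dotE -!p0 /GRing.scale/=; move: (H 0 0) (H 0 1) (H 0 _).
  by move: (p 0 0) (p 1 0) (p (1 + 1) 0) => a b c a' b' c'; ring.
have ds : is_derive 0 (1 : R) (Num.sqrt \o q) ((2 * enorm G)^-1 * (2 * dot G H)).
  by apply: is_derive1_comp; rewrite -sq0; exact: is_derive1_sqrt.
have sn : (Num.sqrt \o q) 0 != 0 by rewrite /= sq0 enorm_eq0.
have di := is_deriveV sn ds.
have dn i : is_derive x v (fun y => unit_normal F y 0 i)
   ((enorm G)^-1 * (H 0 i - (enorm G) ^- 2 * dot G H * G 0 i)).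
  apply: is_derive_of_line.
  rewrite (_ : (fun s : R => _) = (fun s => ((Num.sqrt \o q) s)^-1) * p i); last first.
    by apply/funext => s; rewrite /unit_normal mxE /enorm -qE mxE.
  apply: is_derive_eq; rewrite /= sq0 p0 /GRing.scale/=.
  move: (H 0 i) (G 0 i) (dot G H) => a b c; field.
  by rewrite enorm_eq0.
have d : derivable (unit_normal F) x v.
  by apply/derivable_mxP => i j; rewrite (ord1 i); case: (dn j).
rewrite derive_mx//; apply/rowP => j; rewrite mxE (@derive_val _ _ _ _ _ _ _ (dn j)).
rewrite /unit_normal -/G -/H !mxE dotZl.
have G1 : enorm G != 0 by rewrite enorm_eq0.
by congr (_ * (_ - _)); field.
Qed.

(** The first-order condition at a minimum, in the form in which it is applied to
    quadratic forms. *)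
Lemma nonneg_quadratic_linear_coef (b c : R) :
  (forall t : R, 0 <= t * b + t ^+ 2 * c) -> b = 0.
Proof.
move=> h; set C := `|c| + 1; have C0 : 0 < C by rewrite ltr_wpDl.
have cC : c <= C - 1 by rewrite addrK ler_norm.
have := h (- b / C).
rewrite (_ : _ + _ = - (b / C) ^+ 2 * (C - c)); last by field; rewrite gt_eqF.
rewrite mulNr oppr_ge0 pmulr_lle0; last by lra.
rewrite le_eqVlt ltNge sqr_ge0 orbF.
by rewrite sqrf_eq0 mulf_eq0 invr_eq0 (gt_eqF C0) orbF => /eqP.
Qed.

Lemma hess_form_continuous F x : continuous (fun v => dot v (hess F x v)).
Proof.
have cc i : continuous (fun v : 'rV[R]_3 => v 0 i * dot v (grad (partial i F) x)).
  have ci : continuous (fun v : 'rV[R]_3 => v 0 i).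
    by move=> v; exact: coord_continuous.
  by move=> v; exact: (cvgM (ci v) (@dotr_continuous _ _ v)).
rewrite [X in continuous X](_ : _ = fun v : 'rV[R]_3 =>
   v 0 0 * dot v (grad (partial 0 F) x) + v 0 1 * dot v (grad (partial 1 F) x)
   + v 0 (1 + 1) * dot v (grad (partial (1 + 1) F) x)).
  move=> v; exact: (cvgD (cvgD (cc 0 v) (cc 1 v)) (cc (1 + 1) v)).
by apply/funext => v; rewrite [LHS]dotE !mxE.
Qed.

Lemma unit_tangents_compact n :
  compact [set v : 'rV[R]_3 | dot n v = 0 /\ enorm v = 1].
Proof.
apply: bounded_closed_compact.
  exists 1; split; first exact: num_real.
  move=> r r1 v [_ v1]; apply/ltW/le_lt_trans/r1.
  by rewrite -v1 norm_le_enorm.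
rewrite [X in closed X](_ : _ =
  (dot n @^-1` [set 0]) `&` ((fun v => enorm (v - 0)) @^-1` [set 1])); last first.
  by apply/seteqP; split => v /=; rewrite subr0.
apply: closedI; apply: preimage_closed; try exact: closed_eq.
  by move=> v _; exact: dot_continuous.
by move=> v _; exact: enorm_dist_continuous.
Qed.

(** The minimum l of the Hessian form on the unit circle of the tangent plane is
    attained at some v by compactness.  There the form minus l times the squared
    norm is minimal, so its linear part vanishes in tangent directions: the
    tangential part of the Hessian applied to v is l v, which makes v an
    eigenvector of the shape operator. *)
Lemma minimal_curvature_direction F p u : C2 F -> grad F p != 0 ->
  u != 0 -> dot u (grad F p) = 0 ->
  exists l, principal_curvature F p (- (l / enorm (grad F p))) /\
    forall v, dot v (grad F p) = 0 -> l * dot v v <= dot v (hess F p v).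
Proof.
move=> CF; set G := grad F p => G0 u0 uG.
have [] := @EVT_min_rV R 3 (fun v => dot v (hess F p v))
  [set v | dot G v = 0 /\ enorm v = 1].
- exists ((enorm u)^-1 *: u); split; first by rewrite dotZr dotC uG mulr0.
  by rewrite enormZ ger0_norm ?invr_ge0 ?enorm_ge0// mulVf// enorm_eq0.
- exact: unit_tangents_compact.
- exact/continuous_subspaceT/hess_form_continuous.
move=> v /set_mem[Gv v1] vmin; set l := dot v (hess F p v) in vmin.
have vv : dot v v = 1 by rewrite -enorm_sq v1 expr1n.
have lmin w : dot w G = 0 -> l * dot w w <= dot w (hess F p w).
  move=> wG; have [->|w0] := eqVneq w 0; first by rewrite !dot0l mulr0.
  have nw : 0 < enorm w by rewrite enorm_gt0.
  have ut : [set v | dot G v = 0 /\ enorm v = 1] ((enorm w)^-1 *: w).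
    split; first by rewrite dotZr dotC wG mulr0.
    by rewrite enormZ gtr0_norm ?invr_gt0// mulVf// gt_eqF.
  have := vmin _ (mem_set ut).
  rewrite hessZ dotZl dotZr mulrA -invfM -expr2 enorm_sq => h.
  have ww : 0 < dot w w by rewrite lt0r dot_eq0 w0 dot_ge0.
  by rewrite -ler_pdivlMr// mulrC.
exists l; split=> //.
have crit w : dot w G = 0 -> dot w (hess F p v) = l * dot v w.
  move=> wG; apply/eqP; rewrite -subr_eq0 -[_ == 0](@mulrI_eq0 _ 2)//.
    apply/eqP/(@nonneg_quadratic_linear_coef _ (dot w (hess F p w) - l * dot w w)).
    move=> t; have := lmin (v + t *: w).
    rewrite dotDl dotZl dotC Gv wG mulr0 addr0 => /(_ erefl).
    rewrite hessD hessZ !(dotDl, dotDr, dotZl, dotZr) vv -/l.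
    rewrite -(hess_sym p v w CF) (dotC (hess F p v)) (dotC w v) -subr_ge0.
    by congr (_ <= _); ring.
  by apply: mulfI; rewrite pnatr_eq0.
exists v; split; [by rewrite -enorm_eq0 v1 oner_eq0|by rewrite dotC|].
rewrite derive_unit_normal// -/G scaleNr; congr (- _).
set n := unit_normal F p; set H := hess F p v in crit *.
have nG : n = (enorm G)^-1 *: G by [].
have g0 : enorm G != 0 by rewrite enorm_eq0.
have nn : dot n n = 1 by rewrite nG dotZl dotZr -enorm_sq; field.
rewrite [l / _]mulrC -scalerA; congr (_ *: _).
set T := H - _; have Tn : dot T n = 0.
  by rewrite dotBl dotZl nn mulr1 dotC subrr.
have tang w : dot w n = 0 -> dot w G = 0.
  by rewrite nG dotZr => /eqP; rewrite mulf_eq0 invr_eq0 (negbTE g0) => /eqP.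
have vn : dot v n = 0 by rewrite nG dotZr dotC Gv mulr0.
apply/eqP; rewrite -subr_eq0 -dot_eq0.
set D := T - l *: v; have DE : D = H - dot n H *: n - l *: v by [].
have Dn : dot D n = 0 by rewrite dotBl dotZl Tn vn; ring.
rewrite {2}DE !dotBr (dotZr (dot n H)) (dotZr l) Dn mulr0 subr0 (crit _ (tang _ Dn)).
by rewrite [dot v _]dotC subrr.
Qed.

Lemma enorm_grad_continuous f : C1 f -> continuous (fun x => enorm (grad f x)).
Proof.
move=> [_ cf].
set q := fun x => partial 0 f x * partial 0 f x + partial 1 f x * partial 1 f x
  + partial (1 + 1) f x * partial (1 + 1) f x.
have cq : continuous q.
  have c i : continuous (fun x => partial i f x * partial i f x).
    by move=> x; exact: (cvgM (cf i x) (cf i x)).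
  move=> x; exact: (cvgD (cvgD (c 0 x) (c 1 x)) (c (1 + 1) x)).
rewrite [X in continuous X](_ : _ = Num.sqrt \o q); last first.
  by apply/funext => y; rewrite /enorm dotE !mxE.
by move=> x; apply: continuous_comp; [exact: cq|exact: sqrt_continuous].
Qed.

(** The supremum of an unbounded set is 0 by convention, so the maximal curvature
    bounds the principal curvatures only because of this.  Pairing the eigenvalue
    equation with the eigenvector bounds a principal curvature at x by the size of
    the Hessian over that of the gradient, a continuous function on a compact set. *)
Lemma curvature_bounded F : C2 F -> compact (zero_set F) -> regular_level_set F ->
  has_ubound [set c | exists x k,
     [/\ zero_set F x, principal_curvature F x k & c = `|k|]].
Proof.
move=> CF cF rF.
have [[x0 Gx0]|E] := pselect (zero_set F !=set0); last first.
  by exists 0 => c [x [k [Gx _ _]]]; case: E; exists x.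
pose b x := enorm (grad (partial 0 F) x) + enorm (grad (partial 1 F) x)
            + enorm (grad (partial (1 + 1) F) x).
have [|m _ mmax] := @EVT_max_rV R 3 (fun x => b x / enorm (grad F x)) _
   (ex_intro _ x0 Gx0) cF.
  apply: continuous_in_subspaceT => x /set_mem Gx.
  have c i := @enorm_grad_continuous _ (CF.2 i) x.
  have g0 : enorm (grad F x) != 0 by rewrite enorm_eq0 rF.
  have cb : b @ x --> b x by exact: (cvgD (cvgD (c 0) (c 1)) (c (1 + 1))).
  have cg : (fun x => (enorm (grad F x))^-1) @ x --> (enorm (grad F x))^-1.
    have cG := @enorm_grad_continuous F CF.1 x.
    exact: (cvgV g0 cG).
  exact: cvgM cb cg.
exists (b m / enorm (grad F m)) => c [x [k [Gx [v [v0 vG Dv]] ->]]].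
apply: le_trans (mmax x (mem_set Gx)).
have G0 := rF _ Gx; have g0 : 0 < enorm (grad F x) by rewrite enorm_gt0.
have vv : 0 < dot v v by rewrite lt0r dot_eq0 v0 dot_ge0.
rewrite ler_pdivlMr// -(ler_pM2r vv).
have kE : k * enorm (grad F x) * dot v v = - dot v (hess F x v).
  have : dot v (- 'D_v (unit_normal F) x) = k * dot v v by rewrite Dv dotZr.
  rewrite derive_unit_normal// dotNr dotZr dotBr (dotZr (dot _ _)).
  rewrite (_ : dot v (unit_normal F x) = 0) ?mulr0 ?subr0; last first.
    by rewrite /unit_normal dotZr vG mulr0.
  rewrite mulrAC => <-; rewrite mulNr mulrAC mulVf ?mul1r// gt_eqF//.
rewrite -[X in `|k| * X](gtr0_norm g0) -[X in _ * X <= _](gtr0_norm vv) -!normrM kE.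
rewrite normrN [X in `|X|]dotE !mxE.
have K i : `|v 0 i * dot v (grad (partial i F) x)|
    <= enorm (grad (partial i F) x) * dot v v.
  rewrite normrM -enorm_sq expr2 mulrCA; apply: ler_pM => //.
    exact: coord_le_enorm.
  by rewrite [leRHS]mulrC; exact: cauchy_schwarz.
by rewrite !mulrDl; exact: ler_norm3.
Qed.

Lemma max_curvature_ge0 F : C2 F -> compact (zero_set F) ->
  regular_level_set F -> 0 <= max_curvature F.
Proof.
move=> CF cF rF; rewrite /max_curvature; set S := (X in sup X).
have [[c Sc]|E] := pselect (S !=set0); last first.
  by rewrite (_ : S = set0) ?sup0//; apply/seteqP; split => // c Sc; case: E; exists c.
apply: le_trans (ub_le_sup (curvature_bounded CF cF rF) Sc).
by case: Sc => [x [k [_ _ ->]]].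
Qed.

Lemma hess_ge_curvature F p v : C2 F -> compact (zero_set F) ->
  regular_level_set F -> zero_set F p -> dot v (grad F p) = 0 ->
  - (max_curvature F * enorm (grad F p) * dot v v) <= dot v (hess F p v).
Proof.
move=> CF cF rF Fp vG; have G0 := rF _ Fp.
have [->|v0] := eqVneq v 0; first by rewrite !dot0l mulr0 oppr0.
have [l [kl lmin]] := minimal_curvature_direction CF G0 v0 vG.
have g0 : 0 < enorm (grad F p) by rewrite enorm_gt0.
apply: le_trans (lmin _ vG); rewrite -mulNr ler_wpM2r ?dot_ge0//.
have : `|- (l / enorm (grad F p))| <= max_curvature F.
  apply: ub_le_sup; first exact: curvature_bounded.
  by exists p, (- (l / enorm (grad F p))).
rewrite normrN normrM normfV (gtr0_norm g0) ler_pdivrMr//.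
by have := ler_norm (- l); rewrite normrN; lra.
Qed.

(** Blaschke's rolling principle in local form: a ball of curvature larger than
    all principal curvatures, tangent to the level set on its positive side,
    stays on that side near the point of tangency.  The condition on w says that
    p + w lies in the ball of radius rho centred at p + rho n; it makes the linear
    term of the Taylor expansion at least g |w| ^ 2 / (2 rho), where g is the norm
    of the gradient, and this beats the quadratic term, which is at least
    - K g |w| ^ 2 / 2 up to errors of higher order. *)
Lemma tangent_ball_positive F p (K rho : R) : C2 F -> F p = 0 -> grad F p != 0 ->
  0 <= K -> 0 < rho -> K * rho < 1 ->
  (forall v, dot v (grad F p) = 0 ->
     - (K * enorm (grad F p) * dot v v) <= dot v (hess F p v)) ->
  exists2 d, 0 < d & forall w, w != 0 -> enorm w < d ->
    dot w w <= 2 * rho * dot w (unit_normal F p) -> 0 < F (p + w).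
Proof.
move=> CF Fp G0 K0 r0 Kr lo; set G := grad F p in G0 lo *.
set g := enorm G in lo *; have g0 : 0 < g by rewrite enorm_gt0.
set n := unit_normal F p.
have nG : n = g^-1 *: G by [].
have Gn w : dot w G = g * dot w n by rewrite nG dotZr mulVKf ?gt_eqF.
have nn : dot n n = 1.
  by rewrite nG dotZl dotZr -enorm_sq -/g; field; rewrite gt_eqF.
have n1 : enorm n = 1 by rewrite /enorm nn sqrtr1.
clearbody n; pose m := 1 - K * rho; have m0 : 0 < m by rewrite subr_gt0.
have eta0 : 0 < g * m / (6 * rho) by rewrite divr_gt0 ?mulr_gt0.
have [d d0 T] := taylor2 p CF eta0.
set C := enorm (hess F p n); have C0 : 0 <= C := enorm_ge0 _.
have C1 : 0 < 3 / 2 * C + 1 by rewrite ltr_wpDl ?mulr_ge0 ?divr_ge0.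
exists (Num.min d (g * m / 3 / (3 / 2 * C + 1))) => [|w w0].
  by rewrite lt_min d0 !divr_gt0 ?mulr_gt0.
rewrite lt_min => /andP[/T + wd]; rewrite Fp subr0 -/G.
move: wd; rewrite ltr_pdivlMr// => wd.
set s := dot w w; set a := dot w n => + sa.
have s0 : 0 < s by rewrite lt0r dot_eq0 w0 dot_ge0.
have nw0 : 0 <= enorm w := enorm_ge0 w.
have a0 : 0 < a by have := lt_le_trans s0 sa; rewrite pmulr_rgt0 ?mulr_gt0.
have aw : a <= enorm w by have := dot_le w n; rewrite n1 mulr1.
(* The curvature bound concerns the tangential part of w only; the normal part is
   quadratic in w, so its contributions to the Hessian form are of third order. *)
pose t := w - a *: n.
have tn : dot t n = 0 by rewrite /t dotBl dotZl nn mulr1 subrr.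
have wE : w = t + a *: n by rewrite subrK.
clearbody t.
have st : s = dot t t + a ^+ 2.
  by rewrite /s [in LHS]wE !(dotDl, dotDr, dotZl, dotZr) (dotC n) tn nn; ring.
have tt0 := dot_ge0 t.
have hw : dot w (hess F p w) = dot t (hess F p t) + 2 * a * dot t (hess F p n)
    + a ^+ 2 * dot n (hess F p n).
  rewrite [in LHS]wE hessD hessZ !(dotDl, dotDr, dotZl, dotZr).
  by rewrite -(hess_sym p n t CF) (dotC (hess F p n)); ring.
have lt : - (K * g * s) <= dot t (hess F p t).
  apply: le_trans (lo t _); last by rewrite Gn tn mulr0.
  by rewrite lerN2 ler_wpM2l ?mulr_ge0 ?(ltW g0)// st lerDl sqr_ge0.
have tw : enorm t <= enorm w.
  by rewrite ler_sqrt ?dot_ge0// -/s st lerDl sqr_ge0.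
have l1 : - (C * enorm w) <= dot t (hess F p n).
  apply: le_trans (dot_ge _ _); rewrite lerN2 -/C mulrC.
  by rewrite ler_wpM2l.
have l2 : - C <= dot n (hess F p n).
  by have := dot_ge n (hess F p n); rewrite n1 mul1r.
have lw : - (K * g * s) - 3 * C * (a * enorm w) <= dot w (hess F p w).
  rewrite hw; move: lt l1 l2 aw a0 nw0 C0; clear.
  move: (dot t _) (dot t _) (dot n _) (enorm w) (K * g * s) => Y X Z N k lt l1 l2 aw a0 N0 C0.
  have : 2 * a * (- (C * N)) <= 2 * a * Y by rewrite ler_wpM2l ?mulr_ge0 ?(ltW a0).
  have : a ^+ 2 * (- C) <= a ^+ 2 * Z by rewrite ler_wpM2l// sqr_ge0.
  have : C * a * a <= C * a * N by rewrite ler_wpM2l ?mulr_ge0 ?(ltW a0).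
  lra.
rewrite Gn -/a ler_norml => /andP[+ _].
move: lw wd sa s0 a0 nw0 C0 m0 g0 r0 K0; clear.
rewrite /m; move: (dot w _) (F _) (enorm w) => Q f N lw wd sa s0 a0 N0 C0 m0 g0 r0 K0 T.
have h1 : a * (3 / 2 * C * N) <= a * (g * (1 - K * rho) / 3).
  by rewrite ler_pM2l//; lra.
have h2 : s * (g * (1 - (1 - K * rho) / 3) / (2 * rho))
   <= a * (g * (1 - (1 - K * rho) / 3)).
  rewrite mulrA mulrAC ler_wpM2r//; last by rewrite ler_pdivrMr ?mulr_gt0//; lra.
  by rewrite mulr_ge0 ?(ltW g0)//; have := mulr_ge0 K0 (ltW r0); lra.
have h3 : 0 < s * g * (1 - K * rho) / (6 * rho) by rewrite !divr_gt0 ?mulr_gt0.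
have h4 : s * (g * (1 - (1 - K * rho) / 3) / (2 * rho)) = 
  s * g * (1 - K * rho) / (6 * rho) + g * (1 - K * rho) / (6 * rho) * s
  + K * g * s / 2.
  by field; rewrite gt_eqF.
lra.
Qed.

End Curvature.

(** * The signed distance to a level set *)

Section Distance.
Variable R : realType.
Implicit Types (F : 'rV[R]_3 -> R) (A : set 'rV[R]_3) (n u v w x y z p q : 'rV[R]_3).

Lemma distances_lbound A x : lbound [set edistance x y | y in A] 0.
Proof. by move=> _ [y _ <-]; exact: enorm_ge0. Qed.

Lemma dist_le A x y : A y -> dist x A <= edistance x y.
Proof.
by move=> Ay; apply: ge_inf; [exists 0; exact: distances_lbound|exists y].
Qed.

Lemma dist_ge0 A x : 0 <= dist x A.
Proof.
have [[y Ay]|A0] := pselect (A !=set0).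
  by apply: lb_le_inf; [exists (edistance x y), y|exact: distances_lbound].
rewrite /dist (_ : [set _ | _ in _] = set0) ?inf0//.
by apply/seteqP; split => // t [y Ay _]; case: A0; exists y.
Qed.

Lemma dist_lipschitz A x y : dist x A - dist y A <= enorm (x - y).
Proof.
have [[a Aa]|A0] := pselect (A !=set0); last first.
  have e z : dist z A = 0.
    rewrite /dist (_ : [set _ | _ in _] = set0) ?inf0//.
    by apply/seteqP; split => // t [b Ab _]; case: A0; exists b.
  by rewrite !e subrr enorm_ge0.
rewrite lerBlDr -lerBlDl; apply: lb_le_inf; first by exists (edistance y a), a.
move=> _ [b Ab <-]; rewrite lerBlDl; apply: le_trans (dist_le x Ab) _.
exact: enorm_tri.
Qed.

Lemma closest_exists A x : compact A -> A !=set0 -> exists p, closest_point A x p.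
Proof.
move=> cA A0.
have [|p /set_mem Ap pmin] := @EVT_min_rV R 3 (fun y => enorm (y - x)) A A0 cA.
  exact/continuous_subspaceT/enorm_dist_continuous.
exists p; split=> // z Az; rewrite /edistance !(enormBC x).
by apply: pmin; rewrite inE.
Qed.

Lemma closest_dist A x p : closest_point A x p -> dist x A = edistance x p.
Proof.
move=> [Ap pmin]; apply/eqP; rewrite eq_le dist_le//=.
by apply: lb_le_inf; [exists (edistance x p), p|move=> _ [z Az <-]; exact: pmin].
Qed.

(** The points of A at distance at least e from p form a compact set, on which the
    distance to x exceeds its minimum over A by a positive amount. *)
Lemma closest_stable A x p e : compact A -> closest_point A x p ->
  (forall q, closest_point A x q -> q = p) -> 0 < e ->
  exists2 d, 0 < d & forall y q, enorm (y - x) < d -> closest_point A y q ->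
    enorm (q - p) < e.
Proof.
move=> cA [Ap pmin] pU e0.
pose B := A `&` ((fun q => enorm (q - p)) @^-1` [set t | e <= t]).
have cB : compact B.
  apply: compact_closedI => //; apply: preimage_closed; last exact: closed_ge.
  by move=> q _; exact: enorm_dist_continuous.
have [B0|B0] := pselect (B !=set0); last first.
  exists 1 => // y q _ [Aq _]; rewrite ltNge; apply/negP => eq.
  by apply: B0; exists q.
have [|m /set_mem[Am em] mmin] := @EVT_min_rV R 3 (fun y => enorm (y - x)) B B0 cB.
  exact/continuous_subspaceT/enorm_dist_continuous.
have xm : enorm (p - x) < enorm (m - x).
  rewrite ltNge; apply/negP => mp; move: em => /=.
  rewrite (pU m) ?subrr ?enorm0 ?leNgt ?e0//; split=> // z Az.
  by apply: le_trans (pmin _ Az); rewrite /edistance !(enormBC x).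
exists ((enorm (m - x) - enorm (p - x)) / 2); first by rewrite divr_gt0// subr_gt0.
move=> y q yx [Aq qmin]; rewrite ltNge; apply/negP => eq.
have Bq : B q by [].
have h1 := mmin q (mem_set Bq); have h2 := qmin _ Ap.
have h3 := enorm_tri q y x; have h4 := enorm_tri y x p.
rewrite /edistance in h2; rewrite (enormBC q y) in h3; rewrite (enormBC x p) in h4.
lra.
Qed.

Lemma ivt_line F x y : continuous F -> F x <= 0 -> 0 <= F y ->
  exists2 t, 0 <= t <= 1 & F (x + t *: (y - x)) = 0.
Proof.
move=> cF Fx Fy; pose g t := F (x + t *: (y - x)).
have g0 : g 0 = F x by rewrite /g scale0r addr0.
have g1 : g 1 = F y by rewrite /g scale1r addrC subrK.
have cg : continuous g.
  by move=> t; apply: continuous_comp; [exact: line_continuous|exact: cF].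
have [|t] := @IVT R g 0 1 0 ler01 (continuous_subspaceT cg).
  by rewrite g0 g1 ge_min Fx le_max Fy orbT.
by rewrite in_itv/= => t01 gt; exists t.
Qed.

Lemma dist_crossing F x y : continuous F -> F x <= 0 -> 0 <= F y ->
  dist x (zero_set F) + dist y (zero_set F) <= enorm (x - y).
Proof.
move=> cF Fx Fy; have [t /andP[t0 t1] Ft] := ivt_line cF Fx Fy.
apply: le_trans (lerD (dist_le x Ft) (dist_le y Ft)) _.
rewrite /edistance opprD addNKr (_ : y + (_ + _) = (1 - t) *: (y - x)); last first.
  by rewrite scalerBl scale1r addrA.
rewrite enormN !enormZ (ger0_norm t0) ger0_norm ?subr_ge0// -mulrDl.
by rewrite subrKC mul1r enormBC.
Qed.

Definition sdist F x : R := Num.sg (F x) * dist x (zero_set F).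

Lemma sdist_ge F x : 0 <= F x -> 0 <= sdist F x.
Proof. by move=> Fx; rewrite mulr_ge0 ?sgr_ge0 ?dist_ge0. Qed.

Lemma sdist_pos F x : 0 < F x -> sdist F x = dist x (zero_set F).
Proof. by move=> Fx; rewrite /sdist gtr0_sg// mul1r. Qed.

Lemma sdist_neg F x : F x < 0 -> sdist F x = - dist x (zero_set F).
Proof. by move=> Fx; rewrite /sdist ltr0_sg// mulN1r. Qed.

Lemma sdist_zero F x : F x = 0 -> sdist F x = 0.
Proof. by move=> Fx; rewrite /sdist Fx sgr0 mul0r. Qed.

Lemma norm_sdist F x : `|sdist F x| <= dist x (zero_set F).
Proof.
rewrite normrM (ger0_norm (dist_ge0 _ _)) ler_piMl ?dist_ge0//.
by rewrite normr_sg; case: (_ != 0); rewrite ?ler01.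
Qed.

(** Between points of opposite signs the segment crosses the level set, so the
    two distances add up to at most its length. *)
Lemma sdist_lipschitz F x y : continuous F -> sdist F x - sdist F y <= enorm (x - y).
Proof.
move=> cF; rewrite /sdist; have d := @dist_lipschitz (zero_set F).
have d0 := @dist_ge0 (zero_set F); have c := dist_crossing cF.
have e := enorm_ge0 (x - y); have s := enormBC x y.
case: (sgrP (F x)) => Fx; case: (sgrP (F y)) => Fy.
- by rewrite !mul0r subrr.
- by have := d0 y; lra.
- by have := c y x (ltW Fy); rewrite Fx lexx => /(_ isT); have := d0 x; lra.
- by have := c y x; rewrite Fy lexx (ltW Fx) => /(_ isT isT); have := d0 y; lra.
- by have := d x y; lra.
- by have := c y x (ltW Fy) (ltW Fx); lra.
- by have := d0 x; lra.
- by have := d0 x; have := d0 y; lra.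
- by have := d y x; lra.
Qed.

Lemma zero_set_opp F : zero_set (- F) = zero_set F.
Proof.
by apply/seteqP; split=> x /eqP/=; rewrite ?oppr_eq0 => /eqP // h; rewrite /zero_set/= fctE h oppr0.
Qed.

Lemma enorm_unit_normal F p : grad F p != 0 -> enorm (unit_normal F p) = 1.
Proof.
move=> G0; have g0 : 0 < enorm (grad F p) by rewrite enorm_gt0.
by rewrite enormZ gtr0_norm ?invr_gt0// mulVf ?gt_eqF.
Qed.

(** Were the displacement from p to x not along the gradient, some direction
    would point both towards x and into the negative side, and a short step
    along it would cross the level set nearer to x than p. *)
Lemma closest_normal_pos F x p : C1 F -> grad F p != 0 ->
  closest_point (zero_set F) x p -> 0 < F x ->
  x - p = dist x (zero_set F) *: unit_normal F p.
Proof.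
move=> CF G0 cp Fx; have cd := closest_dist cp; have [Fp _] := cp.
have cF := C1_continuous CF.
set n := unit_normal F p; set u := x - p; set d := dist _ _.
have du : d = enorm u by exact: cd.
have n1 : enorm n = 1 by exact: enorm_unit_normal.
have nn : dot n n = 1 by rewrite -enorm_sq n1 expr1n.
have g0 : 0 < enorm (grad F p) by rewrite enorm_gt0.
have Gn w : dot w (grad F p) = enorm (grad F p) * dot w n.
  by rewrite dotZr mulVKf ?gt_eqF.
have uE : u = x - p by [].
clearbody n u; apply/eqP; rewrite -subr_eq0; apply/negPn/negP; set w := u - _ => w0.
have ww : 0 < dot w w by rewrite lt0r dot_eq0 w0 dot_ge0.
have nw : 0 < enorm w by rewrite enorm_gt0.
have d0 : 0 <= d by rewrite du enorm_ge0.
have wE : dot w w = 2 * d * (d - dot u n).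
  rewrite /w !(dotBl, dotBr, dotZl, dotZr) (dotC n) nn -enorm_sq -du; ring.
have un : 0 < d - dot u n.
  have d1 : 0 < d.
    rewrite lt0r d0 andbT; apply: contraTneq ww => d00.
    by rewrite wE d00 mulr0 mul0r ltxx.
  by move: ww; rewrite wE pmulr_rgt0// mulr_gt0.
have uw : dot u w = d * (d - dot u n).
  by rewrite /w dotBr dotZr -enorm_sq -du; ring.
have wn : dot w n = - (d - dot u n).
  by rewrite /w dotBl dotZl nn; ring.
clearbody w; pose e := enorm (grad F p) * (d - dot u n) / (2 * enorm w).
have e0 : 0 < e by rewrite !(divr_gt0, mulr_gt0).
have [r r0 H] := C1_expansion p CF e0.
pose t := Num.min (r / (2 * enorm w)) (2^-1).
have t0 : 0 < t by rewrite /t lt_min invr_gt0 divr_gt0 ?mulr_gt0 ?ltr0n.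
have t1 : t <= 2^-1 by rewrite /t ge_min lexx orbT.
have nt : enorm (t *: w) = t * enorm w by rewrite enormZ gtr0_norm.
have tr : enorm (t *: w) < r.
  have : t <= r / (2 * enorm w) by rewrite /t ge_min lexx.
  rewrite ler_pdivlMr ?mulr_gt0// nt; have := mulr_gt0 t0 nw; lra.
have Fz : F (p + t *: w) <= 0.
  have := H _ tr; rewrite Fp subr0 nt Gn dotZl wn ler_norml => /andP[_].
  have -> : e * (t * enorm w) = t * (enorm (grad F p) * (d - dot u n)) / 2.
    by rewrite /e; field; rewrite gt_eqF.
  by have := mulr_gt0 t0 (mulr_gt0 g0 un); lra.
have := dist_crossing cF Fz (ltW Fx); have := dist_ge0 (zero_set F) (p + t *: w).
rewrite -/d enormBC opprD addrA -uE => dz0 dz.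
have : d ^+ 2 <= enorm (u - t *: w) ^+ 2.
  by rewrite ler_pXn2r ?nnegrE ?enorm_ge0//; lra.
rewrite enorm_sq !(dotBl, dotBr, dotZl, dotZr) (dotC w u) -enorm_sq -du uw wE.
have dd : 0 < d * (d - dot u n) by move: ww; rewrite wE; lra.
have := mulr_gt0 t0 dd; set k := d * _ in dd * => tk.
have : t * (t * k) <= 2^-1 * (t * k) by rewrite ler_wpM2r// ltW.
rewrite -[2 * d * _]mulrA -/k; lra.
Qed.

Lemma partial_opp F i : C1 F -> partial i (- F) = - partial i F.
Proof.
by move=> [dF _]; apply/funext => y; rewrite /partial deriveN//; exact: dF.
Qed.

Lemma C1_opp F : C1 F -> C1 (- F).
Proof.
move=> CF; have [dF cF] := CF; split=> [x i|i]; first exact/derivableN/dF.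
by rewrite partial_opp// => x; apply: continuousN; exact: cF.
Qed.

Lemma grad_opp F x : C1 F -> grad (- F) x = - grad F x.
Proof. by move=> CF; apply/rowP => i; rewrite !mxE partial_opp. Qed.

Lemma unit_normal_opp F x : C1 F -> unit_normal (- F) x = - unit_normal F x.
Proof. by move=> CF; rewrite /unit_normal grad_opp// enormN scalerN. Qed.

Lemma closest_normal F x p : C1 F -> grad F p != 0 ->
  closest_point (zero_set F) x p -> x - p = sdist F x *: unit_normal F p.
Proof.
move=> CF G0 cp; have [Fx|Fx|Fx] := ltgtP (F x) 0.
- have := @closest_normal_pos (- F) x p (C1_opp CF).
  rewrite grad_opp// oppr_eq0 zero_set_opp unit_normal_opp// fctE oppr_gt0.
  move=> /(_ G0 cp Fx) ->; rewrite sdist_neg// scalerN.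
  by rewrite (scaleNr (dist x (zero_set F))).
- by rewrite sdist_pos//; exact: closest_normal_pos.
- rewrite sdist_zero// scale0r; apply/eqP; rewrite -enorm_eq0.
  rewrite eq_le enorm_ge0 andbT; have [_ /(_ x Fx)] := cp.
  by rewrite /edistance subrr enorm0.
Qed.

End Distance.

(** * Segments leaving a point that is deep on one side *)

Section Visibility.
Variable R : realType.
Implicit Types (F : 'rV[R]_3 -> R) (n u v w x y z p q o : 'rV[R]_3).

(** Radial projection onto a sphere of radius r is Lipschitz outside the ball; the
    constant 2 is enough here and comes from the triangle inequality alone. *)
Lemma radial_projection_dist (r : R) x y : 0 < r -> r <= enorm x -> r <= enorm y ->
  enorm ((r / enorm y) *: y - (r / enorm x) *: x) <= 2 * enorm (y - x).
Proof.
move=> r0 rx ry; set a := enorm x in rx *; set b := enorm y in ry *.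
have a0 : 0 < a := lt_le_trans r0 rx; have b0 : 0 < b := lt_le_trans r0 ry.
have -> : (r / b) *: y - (r / a) *: x
    = (r / b) *: (y - x) + (r / b * (a - b) / a) *: x.
  by apply: row3P; rewrite !mxE; field; rewrite !gt_eqF.
apply: le_trans (enormD _ _) _; rewrite !enormZ.
have rb : r / b <= 1 by rewrite ler_pdivrMr// mul1r.
have rb0 : 0 < r / b by rewrite divr_gt0.
rewrite (gtr0_norm rb0) normrM normfV (gtr0_norm a0) normrM (gtr0_norm rb0).
rewrite -/a divfK ?gt_eqF// -mulrDr.
have ab : `|a - b| <= enorm (y - x).
  rewrite ler_norml; have := enormD (x - y) y; have := enormD (y - x) x.
  by rewrite !subrK (enormBC x) -/a -/b; lra.
have h0 : 0 <= enorm (y - x) + `|a - b| by rewrite addr_ge0 ?enorm_ge0.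
apply: le_trans (ler_wpM2r h0 rb) _; lra.
Qed.

(** If a ball of radius rho touches the level set at the nearest point of x from
    the positive side, then near x the signed distance is at least the signed
    distance to that ball's boundary.  On the positive side this is the triangle
    inequality at the nearest point, which cannot lie inside the ball; on the
    negative side the radial path to the ball crosses the level set. *)
Lemma sdist_ge_ball F x p (rho d0 : R) : continuous F -> compact (zero_set F) ->
  grad F p != 0 -> closest_point (zero_set F) x p ->
  (forall q, closest_point (zero_set F) x q -> q = p) ->
  x - p = sdist F x *: unit_normal F p -> 0 < rho -> 0 < d0 ->
  (forall w, w != 0 -> enorm w < d0 ->
    dot w w <= 2 * rho * dot w (unit_normal F p) -> 0 < F (p + w)) ->
  sdist F x < rho ->
  exists2 d, 0 < d & forall y, enorm (y - x) < d ->
    rho - enorm (y - (p + rho *: unit_normal F p)) <= sdist F y.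
Proof.
move=> cF cG G0 cp pU; have n1 := enorm_unit_normal G0; have [Fp _] := cp.
move: (unit_normal F p) n1 => n n1 xp r0 d00 ball xr.
set c := p + rho *: n.
have nn : dot n n = 1 by rewrite -enorm_sq n1 expr1n.
have inball z : enorm (z - c) <= rho -> z != p -> enorm (z - p) < d0 -> 0 < F z.
  move=> zc zp zd; have := ball (z - p); rewrite subr_eq0 zp zd subrKC; apply=> //.
  have : enorm (z - c) ^+ 2 <= rho ^+ 2.
    by rewrite ler_pXn2r ?nnegrE ?enorm_ge0 ?(ltW r0).
  rewrite enorm_sq /c opprD addrA.
  by rewrite !(dotBl (z - p)) !(dotBr _ (z - p)) !dotZl !dotZr nn (dotC n); lra.
have [d1 d10 near] := closest_stable cG cp pU d00.
(* If x is off the level set, the points within d2 of x are on the same side. *)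
have [d2 d20 d2P] : exists2 d2, 0 < d2 & sdist F x != 0 -> d2 <= `|sdist F x|.
  have [->|s0] := eqVneq (sdist F x) 0; first by exists 1.
  by exists `|sdist F x|; rewrite ?normr_gt0.
exists (Num.min d1 (Num.min d2 (d0 / 2))) => [|y].
  by rewrite !lt_min d10 d20 divr_gt0.
rewrite !lt_min => /and3P[yd1 yd2 yd0].
have [Fy|Fy] := leP 0 (F y).
- have Gne : zero_set F !=set0 by exists p.
  have [q cq] := closest_exists y cG Gne; have [Fq _] := cq.
  have qc : rho <= enorm (q - c).
    rewrite leNgt; apply/negP => qc.
    have qp : q != p.
      apply: contraTneq qc => ->.
      by rewrite /c opprD addNKr enormN enormZ n1 mulr1 gtr0_norm// ltxx.
    by have := inball q (ltW qc) qp (near _ _ yd1 cq); rewrite Fq ltxx.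
  have -> : sdist F y = enorm (y - q).
    rewrite -[RHS]/(edistance y q) -(closest_dist cq); have [|/sdist_pos//] := leP (F y) 0.
    move=> Fy'; have Fy0 : F y = 0 by apply/eqP; rewrite eq_le Fy Fy'.
    rewrite sdist_zero// (closest_dist cq); apply/eqP; rewrite eq_sym eq_le.
    rewrite enorm_ge0 andbT; have [_ /(_ y Fy0)] := cq.
    by rewrite /edistance subrr enorm0.
  by have := enorm_tri q y c; rewrite (enormBC q y); lra.
have sx0 : sdist F x <= 0.
  rewrite leNgt; apply/negP => sx; have := d2P (lt0r_neq0 sx).
  rewrite gtr0_norm// => d2s; have := sdist_lipschitz x y cF.
  rewrite (sdist_neg Fy) (enormBC x); have := dist_ge0 (zero_set F) y; lra.
have xc : x - c = (sdist F x - rho) *: n.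
  by rewrite /c opprD addrA xp scalerBl.
have xcn : enorm (x - c) = rho - sdist F x.
  by rewrite xc enormZ n1 mulr1 ler0_norm; lra.
rewrite sdist_neg//.
have [yc|yc] := ltP (enorm (y - c)) rho.
  have [sx|sx] := eqVneq (sdist F x) 0.
    have xpE : x = p by apply/eqP; rewrite -subr_eq0 xp sx scale0r.
    have yp : y != p by apply: contraTneq Fy => ->; rewrite Fp ltxx.
    have := inball y (ltW yc) yp; rewrite -xpE => /(_ ltac:(lra)) Fy'.
    by move: (lt_trans Fy Fy'); rewrite ltxx.
  have := d2P sx; rewrite ler0_norm// => d2s.
  by have := enorm_tri x y c; rewrite xcn (enormBC x y); lra.
(* z and p are the radial projections of y and x onto the touching sphere. *)
have b0 : 0 < enorm (y - c) := lt_le_trans r0 yc.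
pose z := c + (rho / enorm (y - c)) *: (y - c).
have zc : enorm (z - c) = rho.
  by rewrite /z addrC addKr enormZ gtr0_norm ?divr_gt0// divfK ?gt_eqF.
have yz : enorm (y - z) = enorm (y - c) - rho.
  have -> : y - z = (1 - rho / enorm (y - c)) *: (y - c).
    by rewrite scalerBl scale1r /z opprD addrA.
  rewrite enormZ ger0_norm; last by rewrite subr_ge0 ler_pdivrMr// mul1r.
  by rewrite mulrBl mul1r divfK// gt_eqF.
have pE : p = c + (rho / enorm (x - c)) *: (x - c).
  have e : rho + rho / (rho - sdist F x) * (sdist F x - rho) = 0 by field; lra.
  by rewrite xcn xc scalerA /c -addrA -scalerDl e scale0r addr0.
have zp : enorm (z - p) < d0.
  have e1 (a b e : 'rV[R]_3) : e + a - (e + b) = a - b.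
    by rewrite opprD addrACA subrr add0r.
  rewrite pE /z e1.
  apply: le_lt_trans (radial_projection_dist r0 _ yc) _; first by rewrite xcn; lra.
  by rewrite opprB addrA subrK mulrC -ltr_pdivlMr.
have Fz : 0 <= F z.
  have [->|zp0] := eqVneq z p; first by rewrite Fp.
  by apply/ltW/inball => //; rewrite zc.
have := dist_crossing cF (ltW Fy) Fz; rewrite yz.
by have := dist_ge0 (zero_set F) z; lra.
Qed.

(** In the sense of touching paraboloids, the Hessian of the signed distance d is
    bounded below by - 1 / (rho - d) whenever K rho < 1: near x the signed distance
    is at least rho minus the distance to the centre of a ball of radius rho, and
    this centre has distance rho - d from x. *)
Lemma sdist_paraboloid_below F x p (rho : R) : smooth F -> compact (zero_set F) ->
  regular_level_set F -> closest_point (zero_set F) x p ->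
  (forall q, closest_point (zero_set F) x q -> q = p) ->
  0 < rho -> max_curvature F * rho < 1 -> sdist F x < rho ->
  exists n, exists2 d, 0 < d & forall v, enorm v < d ->
    sdist F x + dot n v - dot v v / (2 * (rho - sdist F x)) <= sdist F (x + v).
Proof.
move=> sF cG rF cp pU r0 Kr xr; have CF := smooth_C2 sF; have [Fp _] := cp.
have G0 := rF _ Fp; have cF := C1_continuous CF.1.
have xp := closest_normal CF.1 G0 cp.
have K0 := max_curvature_ge0 CF cG rF.
have [d0 d00 ball] := tangent_ball_positive CF Fp G0 K0 r0 Kr
  (fun v => hess_ge_curvature CF cG rF Fp).
have [d d_gt0 H] := sdist_ge_ball cF cG G0 cp pU xp r0 d00 ball xr.
exists (unit_normal F p), d => // v vd.
have xv : x + v - x = v by rewrite addrC addKr.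
have := H (x + v); rewrite xv => /(_ vd); apply: le_trans.
have n1 := enorm_unit_normal G0; move: (unit_normal F p) n1 xp {H ball} => n n1 xp.
rewrite (addrAC x v).
have xc : x - (p + rho *: n) = (sdist F x - rho) *: n.
  by rewrite opprD addrA xp scalerBl.
have A0 : 0 < rho - sdist F x by rewrite subr_gt0.
have xcn : enorm (x - (p + rho *: n)) = rho - sdist F x.
  by rewrite xc enormZ n1 mulr1 ltr0_norm; lra.
have xc0 : x - (p + rho *: n) != 0 by rewrite -enorm_gt0 xcn.
have := enormD_le_quad v xc0; rewrite xcn [in dot (x - _) v]xc dotZl.
have -> : (sdist F x - rho) * dot n v / (rho - sdist F x) = - dot n v.
  by field; rewrite gt_eqF.
lra.
Qed.

Lemma reach_closest (A : set 'rV[R]_3) (h : R) x : compact A -> A !=set0 ->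
  (h%:E < reach A)%E -> dist x A <= h ->
  exists p, closest_point A x p /\ forall q, closest_point A x q -> q = p.
Proof.
move=> cA A0 /ereal_sup_gt[_ [r [r0 rU] <-]]; rewrite lte_fin => hr xh.
have [p [cp pU]] := rU x (le_lt_trans xh hr).
by exists p; split=> // q cq; rewrite (pU _ cq).
Qed.

(** Along the segment from o to y the signed distance has second derivative at
    least - 3 E / 2 in the touching sense, while - (1 - t) ^ 2 E has second
    derivative - 2 E and dominates the signed distance at both ends.  The
    difference therefore has no positive interior maximum. *)
Lemma segment_negative F o y (h E : R) : smooth F -> compact (zero_set F) ->
  regular_level_set F -> (h%:E < reach (zero_set F))%E ->
  h * max_curvature F <= 4^-1 -> 0 < h -> 0 < E -> max_curvature F * h ^+ 2 <= E ->
  E < dist o (zero_set F) -> enorm (y - o) <= h -> F o < 0 -> F y <= 0 ->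
  forall t, 0 <= t -> t < 1 -> F (o + t *: (y - o)) < 0.
Proof.
move=> sF cG rF hreach hK h0 E0 KE oE yo Fo Fy t0 t00 t01.
have CF := smooth_C2 sF; have cF := C1_continuous CF.1.
rewrite ltNge; apply/negP => Ft0.
pose l t := o + t *: (y - o).
have lB s t : l s - l t = (s - t) *: (y - o).
  by rewrite /l opprD addrACA subrr add0r -scalerBl.
have lK t : 0 <= t <= 1 -> dist (l t) (zero_set F) <= h.
  move=> /andP[ta tb]; have [s /andP[sa sb] Fs] := ivt_line cF (ltW Fo) Ft0.
  pose s' := s * t0; have sE : o + s *: (o + t0 *: (y - o) - o) = l s'.
    by rewrite (addrC (o + _)) addKr scalerA.
  rewrite sE in Fs; have s0 : 0 <= s' by rewrite mulr_ge0.
  have s1 : s' <= 1 by rewrite mulr_ile1// ltW.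
  apply: le_trans (dist_le _ Fs) _; rewrite /edistance lB enormZ.
  apply: le_trans yo; rewrite ler_piMl ?enorm_ge0// ler_norml; lra.
pose psi t := sdist F (l t) + E * (1 - t) ^+ 2.
have cpsi : continuous psi.
  have c1 : continuous (fun t => sdist F (l t)).
    have cs : continuous (sdist F).
      by apply: lipschitz_continuous => a b; exact: sdist_lipschitz.
    by move=> t; apply: (@continuous_comp _ _ _ l); [exact: line_continuous|exact: cs].
  have c2 : continuous (fun t : R => 1 - t).
    by move=> t; apply: cvgB; [exact: cvg_cst|exact: cvg_id].
  have c3 : continuous (fun t : R => (1 - t) ^+ 2).
    under eq_fun do rewrite expr2.
    by move=> t; exact: (cvgM (c2 t) (c2 t)).
  have c4 : continuous (fun t : R => E * (1 - t) ^+ 2).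
    by move=> t; apply: cvgM; [exact: cvg_cst|exact: c3].
  by move=> t; exact: (cvgD (c1 t) (c4 t)).
have [m + mmax] := EVT_max ler01 (continuous_subspaceT cpsi).
rewrite in_itv/= => /andP[m0 m1].
have psit0 : 0 < psi t0.
  by rewrite ltr_wpDl ?sdist_ge// mulr_gt0// exprn_gt0// subr_gt0.
have psim : 0 < psi m.
  by apply: lt_le_trans psit0 _; apply: mmax; rewrite in_itv/= t00 ltW.
have {}m0 : 0 < m.
  rewrite lt0r m0 andbT; apply: contraTneq psim => ->.
  by rewrite /psi /l scale0r addr0 subr0 expr1n mulr1 sdist_neg// -leNgt; lra.
have {}m1 : m < 1.
  rewrite lt_neqAle m1 andbT; apply: contraTneq psim => ->.
  rewrite /psi /l scale1r (addrC o) subrK subrr expr0n/= mulr0 addr0 -leNgt.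
  have [Fy0|/eqP Fy0] := eqVneq (F y) 0; first by rewrite sdist_zero.
  rewrite sdist_neg ?oppr_le0 ?dist_ge0// lt_neqAle Fy andbT.
  exact/eqP.
have dm : dist (l m) (zero_set F) <= h by apply: lK; rewrite !ltW.
have Gne : zero_set F !=set0.
  by have [s _ Fs] := ivt_line cF (ltW Fo) Ft0; eexists; exact: Fs.
have [p [cp pU]] := reach_closest cG Gne hreach dm.
(* rho - h is the reciprocal of 3 E / (2 h ^ 2), which turns the touching
   paraboloid at distance at most h into the bound 3 E / 4 on a segment of length
   at most h; K rho <= 1 / 4 + 2 / 3 because K h ^ 2 <= E. *)
pose rho := h + 2 * h ^+ 2 / (3 * E).
have hh : 0 < 2 * h ^+ 2 / (3 * E) by rewrite divr_gt0 ?mulr_gt0.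
have r0 : 0 < rho by rewrite addr_gt0.
have Kr : max_curvature F * rho < 1.
  rewrite mulrDr [X in X + _]mulrC.
  have : max_curvature F * (2 * h ^+ 2 / (3 * E)) <= 2 / 3.
    rewrite mulrA ler_pdivrMr ?mulr_gt0//.
    move: KE; move: (max_curvature F) => K; lra.
  lra.
have sm : sdist F (l m) <= h.
  by apply: le_trans (ler_norm _) _; apply: le_trans (norm_sdist _ _) dm.
have mr : sdist F (l m) < rho by rewrite /rho; lra.
have [n [d d0 H]] := sdist_paraboloid_below sF cG rF cp pU r0 Kr mr.
pose b := dot n (y - o) - 2 * E * (1 - m).
(* b is the slope at m of the parabola touching psi from below, whose leading
   coefficient is E / 4; a small step s with s b >= 0 strictly increases psi. *)
have [s [sd s0 ms bs]] : exists s, [/\ enorm (s *: (y - o)) < d, s != 0,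
    0 <= m + s <= 1 & 0 <= s * b].
  pose e := Num.min (d / (enorm (y - o) + 1) / 2) (Num.min m (1 - m)).
  have yo1 : 0 < enorm (y - o) + 1 by rewrite ltr_wpDl ?enorm_ge0.
  have e0 : 0 < e by rewrite /e !lt_min m0 subr_gt0 m1 !divr_gt0.
  have e1 : e <= m by rewrite /e !ge_min lexx orbT.
  have e2 : e <= 1 - m by rewrite /e !ge_min lexx !orbT.
  have ed : e * enorm (y - o) < d.
    have : e <= d / (enorm (y - o) + 1) / 2 by rewrite /e ge_min lexx.
    rewrite ler_pdivlMr// ler_pdivlMr// mulrDr mulr1; have := enorm_ge0 (y - o).
    by move=> n0; have := mulr_ge0 (ltW e0) n0; lra.
  have [b0|b0] := leP 0 b.
    exists e; split; [by rewrite enormZ gtr0_norm|by rewrite gt_eqF|lra|].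
    by rewrite mulr_ge0// ltW.
  exists (- e); split; [by rewrite enormZ normrN gtr0_norm| | |].
  - by rewrite oppr_eq0 gt_eqF.
  - by apply/andP; split; lra.
  - by rewrite mulNr oppr_ge0 mulr_ge0_le0 ?ltW.
have := mmax (m + s); rewrite in_itv/= ms => /(_ isT); rewrite leNgt => /negP; apply.
have lE : l (m + s) = l m + s *: (y - o) by rewrite /l scalerDl addrA.
rewrite /psi lE; have := H _ sd; rewrite dotZr dotZl dotZr -enorm_sq.
have A0 : 0 < rho - sdist F (l m) by rewrite subr_gt0.
have q : s * (s * enorm (y - o) ^+ 2) / (2 * (rho - sdist F (l m))) <= 3 / 4 * E * s ^+ 2.
  rewrite ler_pdivrMr ?mulr_gt0// mulrA -expr2 [leRHS]mulrAC [leRHS]mulrC.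
  rewrite ler_wpM2l ?sqr_ge0//.
  apply: le_trans (_ : h ^+ 2 <= _).
    by rewrite ler_pXn2r ?nnegrE ?enorm_ge0 ?(ltW h0).
  have : 3 / 4 * E * (2 * (2 * h ^+ 2 / (3 * E))) <= 3 / 4 * E * (2 * (rho - sdist F (l m))).
    by rewrite ler_wpM2l ?mulr_ge0 ?(ltW E0)// ler_wpM2l// /rho; lra.
  by apply: le_trans; rewrite le_eqVlt; apply/orP; left; apply/eqP; field; rewrite gt_eqF.
have s2 : 0 < E * s ^+ 2 by rewrite mulr_gt0// exprn_even_gt0.
move: q bs s2; rewrite /b.
move: (sdist F (l m)) (sdist F (l m + _)) (dot n _) (_ / (2 * _)) => A B D Q *; lra.
Qed.

End Visibility.

(** * Simplices and central projections *)

Section Simplices.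
Variable R : realType.
Implicit Types (A D T V : set 'rV[R]_3) (a o p q x y v : 'rV[R]_3) (s : seq 'rV[R]_3).

Lemma segmentE x y (t : R) : x + t *: (y - x) = (1 - t) *: x + t *: y.
Proof. by rewrite scalerBr scalerBl scale1r addrA addrAC. Qed.

Lemma addl_subK x y : x + y - x = y.
Proof. by rewrite addrC addKr. Qed.

Definition segment_closed T :=
  forall x y (t : R), T x -> T y -> 0 <= t -> t <= 1 -> T (x + t *: (y - x)).

Lemma simplex_segment_closed s : segment_closed (simplex s).
Proof.
move=> x y t [l [l0 l1 ->]] [m [m0 m1 ->]] t0 t1.
exists (fun i => (1 - t) * l i + t * m i); split.
- by move=> i; rewrite addr_ge0 ?mulr_ge0 ?subr_ge0.
- by rewrite big_split/= -!mulr_sumr l1 m1 !mulr1 subrK.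
- rewrite segmentE; under [RHS]eq_bigr do rewrite scalerDl -!scalerA.
  by rewrite big_split/= -!scaler_sumr.
Qed.

Lemma simplex1 a x : simplex [:: a] x <-> x = a.
Proof.
split=> [[l [_ l1 ->]]|->].
  by move: l1; rewrite !big_ord_recl !big_ord0 !addr0/= => ->; rewrite scale1r.
exists (fun=> 1); split=> //; first by rewrite big_ord_recl big_ord0 addr0.
by rewrite big_ord_recl big_ord0 addr0 scale1r.
Qed.

(** Simplices enter the argument as iterated cones: visibility is a statement
    about segments from a vertex, and so propagates through cones. *)
Lemma simplex_cone a b s x : simplex [:: a, b & s] x <->
  exists q (t : R), [/\ simplex (b :: s) q, 0 <= t, t <= 1 & x = a + t *: (q - a)].
Proof.
split=> [[l [l0 l1 ->]]|[q [t [[m [m0 m1 ->]] t0 t1 ->]]]].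
  move: l1; rewrite !(@big_ord_recl _ _ _ (size (b :: s)))/=.
  set L := \sum_(i < _) l _ => l1.
  have L0 : 0 <= L by apply: sumr_ge0.
  have lL : l ord0 = 1 - L by rewrite -l1 addrK.
  have [Lz|Ln] := eqVneq L 0.
    exists b, 0; split=> //.
      exists (fun i => if unlift ord0 i is Some j then 0 else 1); split=> [i||].
      - by case: unliftP.
      - rewrite (@big_ord_recl _ _ _ (size s)) unlift_none big1 ?addr0// => i _.
        by rewrite liftK.
      - rewrite (@big_ord_recl _ _ _ (size s)) unlift_none scale1r big1 ?addr0//.
        by move=> i _; rewrite liftK scale0r.
    rewrite lL Lz subr0 scale1r scale0r; congr (_ + _); rewrite big1// => i _.
    move/eqP: Lz; rewrite psumr_eq0 => [|j _]; last exact: l0.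
    by move=> /allP/(_ i); rewrite mem_index_enum => /(_ isT)/= /eqP ->; rewrite scale0r.
  exists (\sum_(i < size (b :: s)) (l (lift ord0 i) / L) *: (b :: s)`_i), L.
  split=> //.
  - exists (fun i => l (lift ord0 i) / L); split=> // [i|].
      by rewrite divr_ge0.
    by rewrite -mulr_suml divff.
  - by have := l0 ord0; rewrite lL subr_ge0.
  - rewrite segmentE -lL; congr (_ + _); rewrite scaler_sumr; apply: eq_bigr => i _.
    by rewrite scalerA mulrCA divff// mulr1.
exists (fun i => if unlift ord0 i is Some j then t * m j else 1 - t); split.
- by move=> i; case: unliftP => [j _|_]; rewrite ?mulr_ge0 ?subr_ge0.
- rewrite (@big_ord_recl _ _ _ (size (b :: s))) unlift_none.
  rewrite (eq_bigr (fun j => t * m j)) => [|j _]; last by rewrite liftK.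
  by rewrite -mulr_sumr m1 mulr1 subrK.
- rewrite (@big_ord_recl _ _ _ (size (b :: s))) unlift_none/=.
  rewrite segmentE; congr (_ + _); rewrite scaler_sumr; apply: eq_bigr => i _.
  by rewrite liftK scalerA.
Qed.

Lemma simplex_subset s T : segment_closed T -> (forall v, v \in s -> T v) ->
  simplex s `<=` T.
Proof.
move=> cT; elim: s => [_ x [l [_]]|a [|b s] IH sT x].
- by rewrite big_ord0 => /eqP; rewrite eq_sym oner_eq0.
- by move=> /simplex1 ->; apply: sT; rewrite mem_head.
- move=> /simplex_cone[q [t [sq t0 t1 ->]]]; apply: cT => //.
    by apply: sT; rewrite mem_head.
  by apply: IH sq => v vs; apply: sT; rewrite inE vs orbT.
Qed.

Lemma simplex_vertex s v : v \in s -> simplex s v.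
Proof.
elim: s v => // a [|b s] IH v; first by rewrite inE => /eqP ->; exact/simplex1.
rewrite inE => /predU1P[->|vs]; apply/simplex_cone.
  by exists b, 0; rewrite scale0r addr0; split=> //; apply: IH; rewrite mem_head.
by exists v, 1; rewrite scale1r subrKC; split=> //; exact: IH.
Qed.

Lemma simplex_sub_simplex s s' : {subset s <= s'} -> simplex s `<=` simplex s'.
Proof.
move=> ss'; apply: simplex_subset; first exact: simplex_segment_closed.
by move=> v /ss'; exact: simplex_vertex.
Qed.

Lemma eq_simplex s s' : s =i s' -> simplex s = simplex s'.
Proof.
by move=> ss'; apply/seteqP; split; apply: simplex_sub_simplex => v; rewrite ss'.
Qed.

Lemma simplex_enorm_bounded s : exists M, forall x, simplex s x -> enorm x <= M.
Proof.
exists (\sum_(v <- s) enorm v); apply: simplex_subset.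
  move=> x y t /= xM yM t0 t1.
  rewrite segmentE; apply: le_trans (enormD _ _) _; rewrite !enormZ !ger0_norm ?subr_ge0//.
  set M := \sum_(_ <- _) _ in xM yM *.
  rewrite (_ : M = (1 - t) * M + t * M); last ring.
  by apply: lerD; rewrite ler_wpM2l// subr_ge0.
move=> v; elim: s => // a s IH; rewrite inE big_cons => /predU1P[->|/IH vM].
  by rewrite lerDl sumr_ge0// => w _; exact: enorm_ge0.
by apply: le_trans vM _; rewrite lerDr enorm_ge0.
Qed.

Lemma simplex_diam s x y : simplex s x -> simplex s y -> enorm (x - y) <= diam (simplex s).
Proof.
move=> sx sy; have [M sM] := simplex_enorm_bounded s.
apply: ub_le_sup; last by exists x, y.
exists (M + M) => _ [a [b [sa sb ->]]].
by apply: le_trans (enormB _ _) _; apply: lerD; exact: sM.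
Qed.

Definition affine_functional (phi : 'rV[R]_3 -> R) :=
  forall x y (t : R), phi (x + t *: (y - x)) = phi x + t * (phi y - phi x).

(** The barycentric coordinates of the first and last vertices.  Such a coordinate
    separates its vertex from the plane of the opposite face, so a ray from the
    vertex meets that plane at most once. *)
Lemma affine_coordinates (o0 o1 o2 o3 : 'rV[R]_3) : affinely_independent o0 o1 o2 o3 ->
  exists phi psi, [/\ affine_functional phi, affine_functional psi,
    [/\ phi o0 = 1, phi o1 = 0, phi o2 = 0 & phi o3 = 0] &
    [/\ psi o0 = 0, psi o1 = 0, psi o2 = 0 & psi o3 = 1]].
Proof.
rewrite /affinely_independent; set X := [:: _; _; _] => fX.
pose c (i : 'I_3) x : R := coord (in_tuple X) i (x - o0).
have c0 i : c i o0 = 0 by rewrite /c subrr linear0.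
have cE (j : 'I_3) x : x - o0 = X`_j -> forall i, c i x = (j == i)%:R.
  by move=> xE i; rewrite /c xE; exact: (@coord_free _ _ _ (in_tuple X) j i fX).
have k1 := cE ord0 o1 erefl.
have k2 : forall i, c i o2 = (inord 1 == i)%:R by apply: cE; rewrite inordK.
have k3 : forall i, c i o3 = (inord 2 == i)%:R by apply: cE; rewrite inordK.
have ca i : affine_functional (c i).
  move=> x y t; have e : y - x = (y - o0) - (x - o0) by rewrite opprB addrA subrK.
  by rewrite /c addrAC linearD linearZ/=; congr (_ + _ * _); rewrite e; exact: linearB.
exists (fun x => 1 - \sum_i c i x), (c (inord 2)).
have sE x i0 : (forall i, c i x = (i0 == i)%:R) -> \sum_i c i x = 1.
  move=> h; under eq_bigr do rewrite h.
  rewrite (bigD1 i0)//= eqxx big1 ?addr0// => i /negbTE.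
  by rewrite eq_sym => ->.
split; [|exact: ca|split|split].
- move=> x y t; under eq_bigr do rewrite ca.
  by rewrite big_split/= -mulr_sumr big_split/= sumrN; ring.
- by rewrite big1 ?subr0.
- by rewrite (sE _ _ k1) subrr.
- by rewrite (sE _ _ k2) subrr.
- by rewrite (sE _ _ k3) subrr.
- by [].
- by rewrite k1 -val_eqE/= inordK.
- by rewrite k2 -val_eqE/= !inordK.
- by rewrite k3 eqxx.
Qed.

Lemma affine_vanish_simplex phi s : affine_functional phi ->
  (forall v, v \in s -> phi v = 0) -> forall x, simplex s x -> phi x = 0.
Proof.
move=> aphi; apply: simplex_subset => x y t /= x0 y0 _ _.
by rewrite aphi x0 y0 subrr mulr0 addr0.
Qed.

Lemma ray_proj_bijectiveP o A D :
  (forall q r, D q -> D (o + r *: (q - o)) -> r = 1) ->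
  (forall x, A x -> exists q t, [/\ D q, 0 < t & x = o + t *: (q - o)]) ->
  (forall q, D q -> exists2 t, 0 < t & A (o + t *: (q - o))) ->
  (forall q t u, D q -> 0 < t -> t < u -> A (o + t *: (q - o)) ->
     A (o + u *: (q - o)) -> False) ->
  ray_proj_bijective o A D.
Proof.
move=> D1 AD DA Auniq.
have Do q : D q -> q != o.
  move=> Dq; apply/eqP => qo; have := D1 _ 0 Dq.
  by rewrite scale0r addr0 -qo => /(_ Dq)/eqP; rewrite eq_sym oner_eq0.
have rayE q t : D q -> 0 < t -> ray o (o + t *: (q - o)) `&` D = [set q].
  move=> Dq t0; apply/seteqP; split=> [y [[u /= u0 <-]]|y ->].
    rewrite addl_subK scalerA => Dy.
    by rewrite /= (D1 _ _ Dq Dy) scale1r subrKC.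
  split=> //; exists t^-1; first by rewrite /= invr_ge0 ltW.
  by rewrite addl_subK scalerA mulVf ?gt_eqF// scale1r subrKC.
have projE q t : D q -> 0 < t -> ray_proj o D (o + t *: (q - o)) = q.
  by move=> Dq t0; rewrite /ray_proj rayE//; apply: get_unique.
split=> [x /AD[q [t [Dq t0 ->]]]|].
  rewrite projE// rayE//; split=> //.
  rewrite -subr_eq0 addl_subK scaler_eq0 gt_eqF//= subr_eq0; exact: Do.
split.
- by move=> x /AD[q [t [Dq t0 ->]]]; rewrite projE.
- move=> x y /set_mem Ax /set_mem Ay.
  have [q [t [Dq t0 xE]]] := AD _ Ax; have [q' [u [Dq' u0 yE]]] := AD _ Ay.
  rewrite xE yE !projE// => qq'; rewrite -{}qq' in yE *.
  rewrite xE in Ax; rewrite yE in Ay.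
  by have [tu|ut|->//] := ltgtP t u; [case: (Auniq q t u)|case: (Auniq q u t)].
- move=> q Dq; have [t t0 At] := DA _ Dq.
  by exists (o + t *: (q - o)) => //; exact: projE.
Qed.

End Simplices.

(** * The level set inside the tetrahedron *)

Section Tetrahedron.
Variable R : realType.
Implicit Types (f F : 'rV[R]_3 -> R) (T : set 'rV[R]_3) (a o p q x y v : 'rV[R]_3)
  (s V : seq 'rV[R]_3).

(** Once this is known for F and - F, the metric hypotheses can be forgotten: beyond
    it, the three cases use only the continuity of F and the signs at the vertices. *)
Definition visible f V T := forall a y, a \in V -> T y -> f a < 0 -> f y <= 0 ->
  forall t, 0 <= t -> t < 1 -> f (a + t *: (y - a)) < 0.

(** Induction on the vertices: every point of a cone over a face lies on a segment
    from a negative vertex to a point of that face, where f <= 0. *)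
Lemma visible_simplex f V T s p : visible f V T -> segment_closed T ->
  (forall v, v \in V -> T v) -> T p -> f p <= 0 ->
  (forall v, v \in s -> v \in V /\ f v < 0) ->
  forall x, simplex (rcons s p) x -> f x < 0 \/ x = p.
Proof.
move=> vf cT VT Tp fp; elim: s => [_ x /simplex1 ->|a s IH sV x]; first by right.
have {}IH := IH (fun v vs => sV v (mem_behead (s := a :: s) vs)).
have [aV fa] := sV a (mem_head _ _).
have sT : simplex (rcons s p) `<=` T.
  apply: simplex_subset => // v; rewrite mem_rcons inE => /predU1P[->//|vs].
  by apply/VT/(sV v _).1; rewrite inE vs orbT.
have [b [s' sE]] : exists b s', rcons s p = b :: s'.
  by case: s {IH sV sT} => [|b s']; [exists p, [::]|exists b, (rcons s' p)].
rewrite rcons_cons sE => /simplex_cone[q [t [sq t0]]]; rewrite -sE in sq.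
rewrite le_eqVlt => /predU1P[->|t1] ->.
  by rewrite scale1r subrKC; exact: IH.
left; apply: vf => //; first exact: sT.
by case: (IH q sq) => [/ltW|->].
Qed.

Lemma visible_ray_zero_unique f V T a q (t u : R) : visible f V T -> a \in V ->
  f a < 0 -> 0 <= t -> t < u -> T (a + u *: (q - a)) ->
  f (a + t *: (q - a)) = 0 -> f (a + u *: (q - a)) = 0 -> False.
Proof.
move=> vf aV fa t0 tu Tu ft fu; have u0 := le_lt_trans t0 tu.
have tu1 : t / u < 1 by rewrite ltr_pdivrMr// mul1r.
have tu0 : 0 <= t / u by rewrite divr_ge0// ltW.
have fu0 : f (a + u *: (q - a)) <= 0 by rewrite fu.
have := vf _ _ aV Tu fa fu0 _ tu0 tu1.
by rewrite addl_subK scalerA divfK ?gt_eqF// ft ltxx.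
Qed.

(** On each ray from the negative vertex a to the base, where f >= 0, a zero exists
    by the intermediate value theorem, and a second one beyond it would make the
    first one negative by visibility. *)
Lemma visible_cone_bijective f V T phi a b s : continuous f -> visible f V T ->
  a \in V -> f a < 0 -> affine_functional phi -> phi a = 1 ->
  (forall v, v \in b :: s -> phi v = 0) ->
  simplex (b :: s) `<=` T -> (forall q, simplex (b :: s) q -> 0 <= f q) ->
  segment_closed T -> T a ->
  ray_proj_bijective a (simplex [:: a, b & s] `&` zero_set f) (simplex (b :: s)).
Proof.
move=> cf vf aV fa aphi phia phis sT fs cT Ta.
have phi0 := affine_vanish_simplex aphi phis.
apply: ray_proj_bijectiveP.
- by move=> q r sq /phi0; rewrite aphi phia (phi0 _ sq); lra.
- move=> x [/simplex_cone[q [t [sq t0 t1 ->]]] fx]; exists q, t; split=> //.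
  rewrite lt0r t0 andbT; apply: contraTneq fa => tz.
  by move: fx; rewrite /zero_set/= tz scale0r addr0 => ->; rewrite ltxx.
- move=> q sq; have [t /andP[t0 t1] ft] := ivt_line cf (ltW fa) (fs _ sq).
  exists t; last by split=> //; apply/simplex_cone; exists q, t.
  rewrite lt0r t0 andbT; apply: contraTneq fa => tz.
  by move: ft; rewrite tz scale0r addr0 => ->; rewrite ltxx.
move=> q t u sq t0 tu [_ ft] [su fu].
have Tu : T (a + u *: (q - a)).
  have /simplex_cone[q' [u' [sq' u0 u1 ->]]] := su.
  by apply: cT => //; exact: sT.
exact: (visible_ray_zero_unique vf aV fa (ltW t0) tu Tu ft fu).
Qed.

Lemma edge_crossing f V T a b : continuous f -> visible f V T -> segment_closed T ->
  a \in V -> T a -> T b -> f a < 0 -> 0 < f b ->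
  exists m p, [/\ 0 < m, m < 1, p = a + m *: (b - a), f p = 0 &
    simplex [:: a; b] `&` zero_set f = [set p]].
Proof.
move=> cf vf cT aV Ta Tb fa fb.
have [m /andP[m0 m1] fm] := ivt_line cf (ltW fa) (ltW fb).
have {}m0 : 0 < m.
  rewrite lt0r m0 andbT; apply: contraTneq fa => mz.
  by move: fm; rewrite mz scale0r addr0 => ->; rewrite ltxx.
have {}m1 : m < 1.
  rewrite lt_neqAle m1 andbT; apply: contraTneq fb => mz.
  by move: fm; rewrite mz scale1r subrKC => ->; rewrite ltxx.
exists m, (a + m *: (b - a)); split=> //.
have uniq t u : 0 <= t -> t < u -> u <= 1 -> f (a + t *: (b - a)) = 0 ->
    f (a + u *: (b - a)) = 0 -> False.
  move=> t0 tu u1; apply: (visible_ray_zero_unique vf aV fa t0 tu).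
  by apply: cT => //; exact/ltW/(le_lt_trans t0 tu).
apply/seteqP; split=> [x [/simplex_cone[q [t [/simplex1 -> t0 t1 ->]]] ft]|x ->].
  have [tm|mt|->//] := ltgtP t m; exfalso.
    by apply: (uniq t m) => //; exact: ltW.
  by apply: (uniq m t) => //; exact: ltW.
split=> //; apply/simplex_cone; exists b, m; split; rewrite ?ltW//.
exact/simplex1.
Qed.

(** A point of the edge from o1 to o2 lies on one side of p, and T is a cone over a
    cone over that edge. *)
Lemma split_simplex (o0 o1 o2 o3 p : 'rV[R]_3) (m : R) : 0 < m -> m < 1 ->
  p = o1 + m *: (o2 - o1) ->
  simplex [:: o0; o1; o2; o3] =
  simplex [:: o0; o1; o3; p] `|` simplex [:: o0; o2; o3; p].
Proof.
move=> m0 m1 pE.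
have perm1 : simplex [:: o0; o1; o2; o3] = simplex [:: o0; o3; o1; o2].
  by apply: eq_simplex => v; rewrite !inE; congr (_ || _); rewrite orbA orbC.
have perm2 q q' : simplex [:: o0; q; o3; q'] = simplex [:: o0; o3; q; q'].
  by apply: eq_simplex => v; rewrite !inE; congr (_ || _); exact: orbCA.
have pT : simplex [:: o0; o1; o2; o3] p.
  rewrite pE; apply: simplex_segment_closed; try exact: ltW.
    by apply: simplex_vertex; rewrite !inE eqxx orbT.
  by apply: simplex_vertex; rewrite !inE eqxx !orbT.
have sub q q' : q \in [:: o0; o1; o2; o3] -> simplex [:: o0; o1; o2; o3] q' ->
    simplex [:: o0; q; o3; q'] `<=` simplex [:: o0; o1; o2; o3].
  move=> qV q'T; apply: simplex_subset; first exact: simplex_segment_closed.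
  move=> v; rewrite !inE => /or4P[] /eqP -> //; apply: simplex_vertex => //.
    by rewrite mem_head.
  by rewrite !inE eqxx !orbT.
apply/seteqP; split=> [x|x [|]]; last 2 first.
- by apply: sub => //; rewrite !inE eqxx orbT.
- by apply: sub => //; rewrite !inE eqxx !orbT.
rewrite perm1 => /simplex_cone[q [t [/simplex_cone[r [s [sr s0 s1 qE]]] t0 t1 xE]]].
have join v w : simplex [:: v; w] r -> simplex [:: o0; v; o3; w] x.
  move=> vwr; rewrite perm2; apply/simplex_cone; exists q, t; split=> //.
  by apply/simplex_cone; exists r, s.
move: sr => /simplex_cone[_ [u [/simplex1 -> u0 u1 rE]]].
have [um|mu] := leP u m; [left|right]; apply: join; apply/simplex_cone; exists p.
  exists (u / m); split; [exact/simplex1|by rewrite divr_ge0// ltW| |].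
    by rewrite ler_pdivrMr// mul1r.
  by rewrite rE pE addl_subK scalerA divfK// gt_eqF.
have m10 : 0 < 1 - m by rewrite subr_gt0.
exists ((1 - u) / (1 - m)); split; [exact/simplex1| | |].
- by rewrite divr_ge0 ?subr_ge0// ltW.
- by rewrite ler_pdivrMr// mul1r; lra.
- by rewrite rE pE; apply: row3P; rewrite !mxE; field; rewrite gt_eqF.
Qed.

Lemma one_negative_vertex f (o0 o1 o2 o3 : 'rV[R]_3) :
  let V := [:: o0; o1; o2; o3] in
  continuous f -> affinely_independent o0 o1 o2 o3 ->
  visible f V (simplex V) -> visible (- f) V (simplex V) ->
  f o0 < 0 -> 0 < f o1 -> 0 < f o2 -> 0 < f o3 ->
  ray_proj_bijective o0 (simplex V `&` zero_set f) (simplex [:: o1; o2; o3]).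
Proof.
move=> V cf indep vf vNf f0 f1 f2 f3.
have [phi [_ [aphi _ [phi0 phi1 phi2 phi3] _]]] := affine_coordinates indep.
have VT := @simplex_vertex _ V.
have i3 : o3 \in V by rewrite !inE eqxx !orbT.
have sT : simplex [:: o1; o2; o3] `<=` simplex V.
  by apply: simplex_sub_simplex => v vs; rewrite inE vs orbT.
apply: (visible_cone_bijective cf vf _ f0 aphi) => //; first exact: mem_head.
- by move=> v; rewrite !inE => /or3P[] /eqP ->.
- move=> q sq; have f3' : (- f) o3 <= 0 by rewrite fctE oppr_le0 ltW.
  have [||] := @visible_simplex _ _ _ [:: o1; o2] o3 vNf
    (@simplex_segment_closed _ V) VT (VT _ i3) f3' _ q sq.
  + by move=> v; rewrite !inE => /orP[] /eqP ->; rewrite eqxx !orbT fctE oppr_lt0.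
  + by rewrite fctE oppr_lt0 => /ltW.
  + by move=> ->; exact: ltW.
- exact: simplex_segment_closed.
- exact/VT/mem_head.
Qed.

(** Away from p, f is negative on the triangle o0 o1 p and positive on o2 o3 p, so
    each half of the tetrahedron is a cone with f of opposite signs at the apex and
    on the base; for the apex o3 the roles of f and - f are exchanged. *)
Lemma two_negative_vertices f (o0 o1 o2 o3 : 'rV[R]_3) :
  let V := [:: o0; o1; o2; o3] in
  continuous f -> affinely_independent o0 o1 o2 o3 ->
  visible f V (simplex V) -> visible (- f) V (simplex V) ->
  f o0 < 0 -> f o1 < 0 -> 0 < f o2 -> 0 < f o3 ->
  exists p : 'rV[R]_3,
    let T1 := simplex [:: o0; o1; o3; p] in
    let T2 := simplex [:: o0; o2; o3; p] in
    [/\ simplex [:: o1; o2] `&` zero_set f = [set p],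
        ray_proj_bijective o3 (T1 `&` zero_set f) (simplex [:: o0; o1; p]),
        ray_proj_bijective o0 (T2 `&` zero_set f) (simplex [:: o2; o3; p]) &
        simplex V `&` zero_set f = (T1 `&` zero_set f) `|` (T2 `&` zero_set f)].
Proof.
move=> V cf indep vf vNf f0 f1 f2 f3.
have [phi [psi [aphi apsi [phi0 phi1 phi2 phi3] [psi0 psi1 psi2 psi3]]]] :=
  affine_coordinates indep.
have VT := @simplex_vertex _ V; have cT := @simplex_segment_closed _ V.
have i0 : o0 \in V by rewrite !inE eqxx.
have i1 : o1 \in V by rewrite !inE eqxx orbT.
have i2 : o2 \in V by rewrite !inE eqxx !orbT.
have i3 : o3 \in V by rewrite !inE eqxx !orbT.
have [m [p [m0 m1 pE fp edge]]] := edge_crossing cf vf cT i1 (VT _ i1) (VT _ i2) f1 f2.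
have Tp : simplex V p by rewrite pE; apply: cT; rewrite ?ltW//; exact: VT.
have Nf : zero_set (- f) = zero_set f := zero_set_opp f.
have cNf : continuous (- f) by move=> x; exact/continuousN/cf.
exists p; split=> //.
- rewrite (@eq_simplex _ [:: o0; o1; o3; p] [:: o3; o0; o1; p]); last first.
    by move=> v; rewrite !inE [(v == o1) || _]orbCA orbCA.
  rewrite -Nf; have f3' : (- f) o3 < 0 by rewrite fctE oppr_lt0.
  apply: (visible_cone_bijective cNf vNf i3 f3' apsi) => //; last exact: VT.
  + move=> v; rewrite !inE => /or3P[] /eqP -> //.
    by rewrite pE apsi psi1 psi2 subrr mulr0 addr0.
  + by apply: simplex_subset => // v; rewrite !inE => /or3P[] /eqP ->//; exact: VT.
  + move=> q sq; rewrite fctE oppr_ge0.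
    have [|| |->] := @visible_simplex _ _ _ [:: o0; o1] p vf cT VT Tp _ _ q sq.
    * by rewrite fp.
    * by move=> v; rewrite !inE => /orP[] /eqP ->; rewrite eqxx ?orbT.
    * exact: ltW.
    * by rewrite fp.
- apply: (visible_cone_bijective cf vf i0 f0 aphi) => //; last exact: VT.
  + move=> v; rewrite !inE => /or3P[] /eqP -> //.
    by rewrite pE aphi phi1 phi2 subrr mulr0 addr0.
  + by apply: simplex_subset => // v; rewrite !inE => /or3P[] /eqP ->//; exact: VT.
  + move=> q sq.
    have [|| |->] := @visible_simplex _ _ _ [:: o2; o3] p vNf cT VT Tp _ _ q sq.
    * by rewrite fctE fp oppr0.
    * by move=> v; rewrite !inE => /orP[] /eqP ->; rewrite eqxx ?orbT fctE oppr_lt0.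
    * by rewrite fctE oppr_lt0 => /ltW.
    * by rewrite fp.
- by rewrite (split_simplex o0 o3 m0 m1 pE) setIUl.
Qed.

End Tetrahedron.

(** * Reversing the orientation *)

Section Orientation.
Variable R : realType.
Implicit Types (F : 'rV[R]_3 -> R) (x v : 'rV[R]_3).

Lemma smooth_opp F : smooth F -> smooth (- F).
Proof.
move=> sF.
have E s : iter_partial s (- F) = - iter_partial s F.
  elim: s => //= i s ->; apply/funext => x.
  by rewrite /partial deriveN//; exact: (sF s).2.
move=> s; rewrite E; split.
  by move=> x; apply: continuousN; exact: (sF s).1.
by move=> x i; apply: derivableN; exact: (sF s).2.
Qed.

Lemma regular_opp F : smooth F -> regular_level_set F -> regular_level_set (- F).
Proof.
move=> /smooth_C2[CF _] rF x; rewrite zero_set_opp => Fx.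
by rewrite grad_opp// oppr_eq0 rF.
Qed.

Lemma hess_opp F x v : C2 F -> hess (- F) x v = - hess F x v.
Proof.
move=> [CF CiF]; apply/rowP => i; rewrite !mxE partial_opp//.
by rewrite grad_opp// dotNr.
Qed.

Lemma principal_curvature_opp F x k : C2 F -> grad F x != 0 ->
  principal_curvature F x k -> principal_curvature (- F) x (- k).
Proof.
move=> CF G0 [v [v0 vG Dv]]; exists v; split=> //.
  by rewrite (grad_opp x CF.1) dotNr vG oppr0.
have [C1F CiF] := CF; have CNF : C2 (- F).
  split; first exact: C1_opp.
  by move=> i; rewrite partial_opp//; exact/C1_opp/CiF.
have NG0 : grad (- F) x != 0 by rewrite grad_opp// oppr_eq0.
rewrite (derive_unit_normal v CNF NG0) (grad_opp x C1F) enormN hess_opp// unit_normal_opp//.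
rewrite dotNl dotNr opprK scalerN -opprD scalerN opprK.
move: Dv; rewrite derive_unit_normal// => Dv.
by rewrite scaleNr -Dv opprK.
Qed.

Lemma max_curvature_opp F : smooth F -> regular_level_set F ->
  max_curvature (- F) = max_curvature F.
Proof.
move=> sF rF; have CF := smooth_C2 sF.
have CNF := smooth_C2 (smooth_opp sF); have rNF := regular_opp sF rF.
pose S G := [set c | exists x k,
  [/\ zero_set G x, principal_curvature G x k & c = `|k|]].
suff e : S (- F) = S F by rewrite -[LHS]/(sup (S (- F))) e.
apply/seteqP; split=> c [x [k [Fx kx ->]]].
  have := principal_curvature_opp CNF (rNF _ Fx) kx; rewrite opprK => kx'.
  by exists x, (- k); split=> //; [rewrite -zero_set_opp|rewrite normrN].
have kx' := principal_curvature_opp CF (rF _ Fx) kx.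
by exists x, (- k); split=> //; [rewrite zero_set_opp|rewrite normrN].
Qed.

End Orientation.

(** * Consistent tetrahedra *)

Section Consistent.
Variable R : realType.
Implicit Types (F : 'rV[R]_3 -> R) (o x y v : 'rV[R]_3).

Lemma consistent_visible F (c0 : R) (o0 o1 o2 o3 : 'rV[R]_3) :
  smooth F -> compact (zero_set F) -> regular_level_set F -> 0 < c0 ->
  affinely_independent o0 o1 o2 o3 -> consistent F c0 o0 o1 o2 o3 ->
  visible F [:: o0; o1; o2; o3] (simplex [:: o0; o1; o2; o3]).
Proof.
move=> sF cF rF c00 indep [hr hK deep] a y aV Ty Fa Fy.
set h := diam _ in hr hK deep; set K := max_curvature F in hK deep.
have h0 : 0 < h.
  have [phi [_ [_ _ [p0 p1 _ _] _]]] := affine_coordinates indep.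
  have o10 : o1 - o0 != 0.
    rewrite subr_eq0; apply/eqP => o10; move: p1; rewrite o10 p0.
    by move/eqP; rewrite oner_eq0.
  rewrite -enorm_gt0 in o10; apply: lt_le_trans o10 _; apply: simplex_diam.
    by apply: simplex_vertex; rewrite !inE eqxx orbT.
  by apply: simplex_vertex; rewrite inE eqxx.
apply: (@segment_negative _ _ _ _ h (Num.max (c0 * h) (K * h ^+ 2))) => //.
- by rewrite lt_max mulr_gt0.
- by rewrite le_max lexx orbT.
- exact: deep.
- by apply: simplex_diam => //; exact: simplex_vertex.
Qed.

Lemma consistent_opp F (c0 : R) (o0 o1 o2 o3 : 'rV[R]_3) :
  smooth F -> regular_level_set F ->
  consistent F c0 o0 o1 o2 o3 -> consistent (- F) c0 o0 o1 o2 o3.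
Proof. by move=> sF rF; rewrite /consistent zero_set_opp max_curvature_opp. Qed.

Lemma consistent_vertex_neq0 F (c0 : R) (o0 o1 o2 o3 o : 'rV[R]_3) : 0 <= c0 ->
  consistent F c0 o0 o1 o2 o3 -> o \in [:: o0; o1; o2; o3] -> F o != 0.
Proof.
move=> c00 [_ _ deep] oV; apply/eqP => Fo; have := deep o oV.
apply/negP; rewrite -leNgt.
have d0 := @dist_le _ (zero_set F) o o Fo.
rewrite /edistance subrr enorm0 in d0; apply: le_trans d0 _.
rewrite le_max mulr_ge0//.
have o0T : simplex [:: o0; o1; o2; o3] o0 by apply: simplex_vertex; rewrite mem_head.
by have := simplex_diam o0T o0T; rewrite subrr enorm0.
Qed.

End Consistent.

Theorem theorem2p1 (R : realType) (F : 'rV[R]_3 -> R) (c0 : R)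
    (o0 o1 o2 o3 : 'rV[R]_3)
    (Fsmooth : smooth F)
    (Fcompact : compact (zero_set F))
    (Fregular : regular_level_set F)
    (c0_gt0 : 0 < c0)
    (o_indep : affinely_independent o0 o1 o2 o3)
    (Tconsistent : consistent F c0 o0 o1 o2 o3) :
  let Gamma := zero_set F in
  let T := simplex [:: o0; o1; o2; o3] in
  [/\ (* Case 1 *)
      [/\ Num.sg (F o0) = Num.sg (F o1), Num.sg (F o1) = Num.sg (F o2) &
          Num.sg (F o2) = Num.sg (F o3)] ->
      Gamma `&` T = set0,
      (* Case 2 *)
      [/\ - Num.sg (F o0) = Num.sg (F o1), Num.sg (F o1) = Num.sg (F o2) &
          Num.sg (F o2) = Num.sg (F o3)] ->
      ray_proj_bijective o0 (T `&` Gamma) (simplex [:: o1; o2; o3]) &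
      (* Case 3 *)
      [/\ - Num.sg (F o0) = - Num.sg (F o1),
          - Num.sg (F o1) = Num.sg (F o2) &
          Num.sg (F o2) = Num.sg (F o3)] ->
      exists p : 'rV[R]_3,
        let T1 := simplex [:: o0; o1; o3; p] in
        let T2 := simplex [:: o0; o2; o3; p] in
        [/\ simplex [:: o1; o2] `&` Gamma = [set p],
            ray_proj_bijective o3 (T1 `&` Gamma) (simplex [:: o0; o1; p]),
            ray_proj_bijective o0 (T2 `&` Gamma) (simplex [:: o2; o3; p]) &
            T `&` Gamma = (T1 `&` Gamma) `|` (T2 `&` Gamma)]].
Proof.
move=> Gamma T.
have vF : visible F [:: o0; o1; o2; o3] T by apply: consistent_visible Tconsistent.
have vNF : visible (- F) [:: o0; o1; o2; o3] T.
  apply: (@consistent_visible _ _ c0) => //.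
  - exact: smooth_opp.
  - by rewrite zero_set_opp.
  - exact: regular_opp.
  - exact: consistent_opp.
have cF : continuous F := C1_continuous (smooth_C2 Fsmooth).1.
have cNF : continuous (- F) by move=> x; exact/continuousN/cF.
have vNNF : visible (- - F) [:: o0; o1; o2; o3] T by rewrite opprK.
have zN : zero_set (- F) = Gamma := zero_set_opp F.
have F0 := consistent_vertex_neq0 (ltW c0_gt0) Tconsistent.
have sgP x y : Num.sg (F x) = Num.sg (F y) ->
    (F x < 0 -> F y < 0) /\ (0 < F x -> 0 < F y).
  by move=> e; split; rewrite -1?sgr_lt0 -1?sgr_gt0 e ?sgr_lt0 ?sgr_gt0.
have sgN x y : - Num.sg (F x) = Num.sg (F y) ->
    (F x < 0 -> 0 < F y) /\ (0 < F x -> F y < 0).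
  move=> e; split; first by rewrite -sgr_lt0 -oppr_gt0 e sgr_gt0.
  by rewrite -sgr_gt0 -oppr_lt0 e sgr_lt0.
have oV : o0 \in [:: o0; o1; o2; o3] by rewrite mem_head.
have o3V : o3 \in [:: o0; o1; o2; o3] by rewrite !inE eqxx !orbT.
split.
- move=> [e01 e12 e23].
  have neg f : visible f [:: o0; o1; o2; o3] T -> f o0 < 0 -> f o1 < 0 ->
      f o2 < 0 -> f o3 < 0 -> forall x, T x -> f x < 0.
    move=> vf f0 f1 f2 f3 x Tx.
    have good v : v \in [:: o0; o1; o2] -> v \in [:: o0; o1; o2; o3] /\ f v < 0.
      by rewrite !inE => /or3P[] /eqP ->; rewrite eqxx ?orbT.
    have [|->] := @visible_simplex _ _ _ _ [:: o0; o1; o2] o3 vf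
      (@simplex_segment_closed _ _) (@simplex_vertex _ _) (simplex_vertex o3V)
      (ltW f3) good x Tx; by [].
  apply/seteqP; split=> // x [Fx Tx].
  have [Fo|Fo|/eqP] := ltgtP (F o0) 0; last by rewrite (negbTE (F0 _ oV)).
    have F1 := (sgP _ _ e01).1 Fo; have F2 := (sgP _ _ e12).1 F1.
    have := neg F vF Fo F1 F2 ((sgP _ _ e23).1 F2) x Tx.
    by rewrite Fx ltxx.
  have F1 := (sgP _ _ e01).2 Fo; have F2 := (sgP _ _ e12).2 F1.
  have F3 := (sgP _ _ e23).2 F2.
  have := neg (- F) vNF; rewrite !fctE !oppr_lt0 => /(_ Fo F1 F2 F3 x Tx).
  by rewrite oppr_lt0 Fx ltxx.
- move=> [e01 e12 e23].
  have [Fo|Fo|/eqP] := ltgtP (F o0) 0; last by rewrite (negbTE (F0 _ oV)).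
    have F1 := (sgN _ _ e01).1 Fo; have F2 := (sgP _ _ e12).2 F1.
    exact: one_negative_vertex ((sgP _ _ e23).2 F2).
  have F1 := (sgN _ _ e01).2 Fo; have F2 := (sgP _ _ e12).1 F1.
  have F3 := (sgP _ _ e23).1 F2; rewrite -zN.
  by apply: one_negative_vertex => //; rewrite fctE ?oppr_lt0 ?oppr_gt0.
- move=> [/oppr_inj e01 e12 e23].
  have [Fo|Fo|/eqP] := ltgtP (F o0) 0; last by rewrite (negbTE (F0 _ oV)).
    have F1 := (sgP _ _ e01).1 Fo; have F2 := (sgN _ _ e12).1 F1.
    exact: two_negative_vertices ((sgP _ _ e23).2 F2).
  have F1 := (sgP _ _ e01).2 Fo; have F2 := (sgN _ _ e12).2 F1.
  have F3 := (sgP _ _ e23).1 F2; rewrite -zN.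
  by apply: two_negative_vertices => //; rewrite fctE ?oppr_lt0 ?oppr_gt0.
Qed.
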